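(* Let $C:[0,\infty)\rightsquigarrow\mathbb{R}^n$ satisfy $(H_C)$ with Lipschitz constant $L_C$ and let $G:[0,\infty)\times\mathbb{R}^n\rightsquigarrow\mathbb{R}^n$ satisfy $(H_G)$ with bound $M$ (assumptions spelled out in the context). Let $K\subseteq\mathbb{R}^n$ be closed and such that $C(t)\cap K\neq\emptyset$ for all $t\ge0$, and set $\mathcal{K}:=[0,\infty)\times K$. For $t_0\ge0$ and $x_0\in K\cap C(t_0)$ consider the Cauchy problem $$\dot\tau(t)=1,\qquad \dot x(t)\in -N_{C(\tau(t))}(x(t))+G(\tau(t),x(t))\ \text{ for a.e. }t>0,\qquad(\tau(0),x(0))=(t_0,x_0).$$ Then $\mathcal{K}$ is weakly invariant for this problem if and only if for every $(\tau,x)\in\mathrm{graph}(C)\cap\mathcal{K}$ one has $$\min_{v\in\{0\}\times(-N_{C(\tau)}(x)\cap(L_C+M)\mathbb{B})}v\cdot p+\min_{v\in\{1\}\times G(\tau,x)}v\cdot p\le0\qquad\forall\,p\in N_{\mathrm{graph}(C)\cap\mathcal{K}}(\tau,x).$$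
   Context: $\mathbb{B}$ is the closed unit ball of $\mathbb{R}^n$; $v\cdot p$ is the Euclidean scalar product. For a set-valued map $F$, $\mathrm{graph}(F)=\{(x,y): y\in F(x)\}$. Proximal normals. For a closed set $A\subset\mathbb{R}^m$ and $x\in A$, the proximal normal cone $N_A(x)$ is the set of $v\in\mathbb{R}^m$ for which there is $\sigma\ge0$ with $v\cdot(y-x)\le\sigma\|y-x\|^2$ for all $y\in A$; $N_A(x)=\emptyset$ if $x\notin A$. Prox-regularity. For $r>0$, a closed set $A$ is $r$-prox-regular if $\zeta\cdot(y-x)\le\frac1{2r}\|\zeta\|\,\|y-x\|^2$ for all $x,y\in A$ and $\zeta\in N_A(x)$. Assumption $(H_C)$: for all $t\ge0$ the set $C(t)$ is nonempty and compact; there is $r>0$ (independent of $t$) such that every $C(t)$ is $r$-prox-regular; and $d_H(C(t),C(s))\le L_C|t-s|$ for all $s,t\ge 0$, with $d_H$ the Hausdorff distance. Assumption $(H_G)$: $G$ has nonempty, closed, convex values; $\|v\|\le M$ for all $v\in G(t,x)$ and all $(t,x)\in[0,\infty)\times\mathbb{R}^n$; $G$ is Lipschitz continuous in $(t,x)$ (for the Hausdorff distance) with constant $L_G$. Solutions are absolutely continuous; along a solution $x(t)\in C(\tau(t))$ for all $t$. Weak invariance: for all $(t_0,x_0)\in\mathrm{graph}(C)\cap\mathcal{K}$ there are $T>0$ and at least one solution $(\tau,x):[0,T]\to\mathbb{R}^{1+n}$ of the Cauchy problem $\dot\tau(t)=1$, $\dot x(t)\in -N_{C(\tau(t))}(x(t))+G(\tau(t),x(t))$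 for a.e. $t\in[0,T]$, $(\tau(0),x(0))=(t_0,x_0)$, such that $(\tau(t),x(t))\in\mathcal{K}$ for all $t\in[0,T)$. *)

(* Defs.v *)
From HB Require Import structures.
From mathcomp Require Import all_boot all_order all_algebra.
From mathcomp Require Import all_classical all_reals all_analysis.

Set Implicit Arguments.
Unset Strict Implicit.
Unset Printing Implicit Defensive.

Import Order.TTheory GRing.Theory Num.Theory.
Import numFieldNormedType.Exports.

Local Open Scope classical_set_scope.
Local Open Scope ring_scope.

(* The library norm on 'rV[R]_n is the sup norm, so the Euclidean structure is
   introduced here; closedness, compactness and derivatives are taken in the
   library topology, which is the Euclidean one. *)
Definition dot (R : realType) (n : nat) (u v : 'rV[R]_n) : R :=
  \sum_(i < n) u 0 i * v 0 i.

Definition enorm (R : realType) (n : nat) (u : 'rV[R]_n) : R :=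
  Num.sqrt (dot u u).

Definition eball (R : realType) (n : nat) (rho : R) : set 'rV[R]_n :=
  [set v | enorm v <= rho].

(* R x R^n is identified with R^(1+n): the pair (t, x) is the row of t
   followed by the entries of x. *)
Definition tx (R : realType) (n : nat) (t : R) (x : 'rV[R]_n) : 'rV[R]_(1 + n) :=
  row_mx (t%:M) x.

Definition dist_to_set (R : realType) (n : nat) (x : 'rV[R]_n)
    (B : set 'rV[R]_n) : \bar R :=
  ereal_inf [set (enorm (x - y))%:E | y in B].

(* Valued in the extended reals; it is the usual Hausdorff distance for
   nonempty sets. *)
Definition hausdorff_dist (R : realType) (n : nat) (A B : set 'rV[R]_n) : \bar R :=
  maxe (ereal_sup [set dist_to_set a B | a in A])
       (ereal_sup [set dist_to_set b A | b in B]).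

Definition proximal_normal (R : realType) (m : nat) (A : set 'rV[R]_m)
    (x : 'rV[R]_m) : set 'rV[R]_m :=
  [set v | A x /\ exists sigma : R, 0 <= sigma /\
     forall y, A y -> dot v (y - x) <= sigma * enorm (y - x) ^+ 2].

Definition prox_regular (R : realType) (m : nat) (r : R) (A : set 'rV[R]_m) : Prop :=
  closed A /\
  forall x y zeta, A x -> A y -> proximal_normal A x zeta ->
    dot zeta (y - x) <= (2 * r)^-1 * enorm zeta * enorm (y - x) ^+ 2.

(* A map defined on [0, oo) is represented by a total function on R of which
   only the values at t >= 0 are ever used. *)
Definition graph (R : realType) (n : nat) (C : R -> set 'rV[R]_n) :
    set 'rV[R]_(1 + n) :=
  [set z | exists (t : R) (x : 'rV[R]_n), [/\ 0 <= t, C t x & z = tx t x]].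

Definition time_cylinder (R : realType) (n : nat) (K : set 'rV[R]_n) :
    set 'rV[R]_(1 + n) :=
  [set z | exists (t : R) (x : 'rV[R]_n), [/\ 0 <= t, K x & z = tx t x]].

Record HC (R : realType) (n : nat) (C : R -> set 'rV[R]_n) (L_C : R) : Prop := {
  HC_nonempty : forall t : R, 0 <= t -> C t !=set0;
  HC_compact : forall t : R, 0 <= t -> compact (C t);
  HC_prox : exists2 r : R, 0 < r & forall t : R, 0 <= t -> prox_regular r (C t);
  HC_lipschitz : forall t s : R, 0 <= t -> 0 <= s ->
    (hausdorff_dist (C t) (C s) <= (L_C * `|t - s|)%:E)%E
}.

Record HG (R : realType) (n : nat) (G : R -> 'rV[R]_n -> set 'rV[R]_n)
    (M L_G : R) : Prop := {
  HG_nonempty : forall (t : R) x, 0 <= t -> G t x !=set0;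
  HG_closed : forall (t : R) x, 0 <= t -> closed (G t x);
  HG_convex : forall (t : R) x, 0 <= t -> convex_set (G t x);
  HG_bounded : forall (t : R) x v, 0 <= t -> G t x v -> enorm v <= M;
  HG_lipschitz : forall (t s : R) x y, 0 <= t -> 0 <= s ->
    (hausdorff_dist (G t x) (G s y) <= (L_G * enorm (tx t x - tx s y))%:E)%E
}.

Definition abs_continuous (R : realType) (m : nat) (a b : R) (f : R -> 'rV[R]_m) :
    Prop :=
  forall e : R, 0 < e -> exists2 d : R, 0 < d &
    forall (k : nat) (u v : 'I_k -> R),
      (forall i, a <= u i /\ u i <= v i /\ v i <= b) ->
      trivIset [set: 'I_k] (fun i => `]u i, v i[%classic) ->
      \sum_(i < k) (v i - u i) < d ->
      \sum_(i < k) enorm (f (v i) - f (u i)) < e.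

(* The functions are total, but their values outside [0, T] only affect the
   differential condition at the end points, which form a null set. *)
Definition is_solution (R : realType) (n : nat) (C : R -> set 'rV[R]_n)
    (G : R -> 'rV[R]_n -> set 'rV[R]_n) (t0 : R) (x0 : 'rV[R]_n) (T : R)
    (tau : R -> R) (x : R -> 'rV[R]_n) : Prop :=
  [/\ abs_continuous 0 T (fun t => tx (tau t) (x t)),
      tau 0 = t0 /\ x 0 = x0,
      forall t : R, 0 <= t <= T -> C (tau t) (x t) &
      {ae (@lebesgue_measure R), forall t : R, 0 <= t <= T ->
        [/\ derivable tau t 1, derive1 tau t = 1, derivable x t 1 &
            [set - zeta + g | zeta in proximal_normal (C (tau t)) (x t)
                            & g in G (tau t) (x t)] (derive1 x t)]}].

Definition weakly_invariant (R : realType) (n : nat) (C : R -> set 'rV[R]_n)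
    (G : R -> 'rV[R]_n -> set 'rV[R]_n) (Kc : set 'rV[R]_(1 + n)) : Prop :=
  forall t0 x0, (graph C `&` Kc) (tx t0 x0) ->
    exists (T : R) (tau : R -> R) (x : R -> 'rV[R]_n),
      [/\ 0 < T, is_solution C G t0 x0 T tau x &
          forall t : R, 0 <= t < T -> Kc (tx (tau t) (x t))].

Definition is_min (R : realType) (A : set R) (m : R) : Prop :=
  A m /\ lbound A m.

(* [min_{v in A} v . p + min_{v in B} v . p <= 0], including that both minima
   are attained. *)
Definition sum_of_mins_le0 (R : realType) (m : nat) (A B : set 'rV[R]_m)
    (p : 'rV[R]_m) : Prop :=
  exists a b : R, [/\ is_min [set dot v p | v in A] a,
                      is_min [set dot v p | v in B] b & a + b <= 0].

(* Main.v *)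
(* Write [S] for the part of the graph of [C] above [K], and [V (t, x)] for the
   set of velocities [- zeta + g] with [zeta] a proximal normal to [C t] at [x]
   in the ball of radius [L_C + M] and [g] in [G t x].

   Necessity. Along a solution the normal component has norm at most
   [L_C + M], since moving backwards in time yields test points of [C (tau t)]
   at distance [O(h)] from [x t]; hence a solution is Lipschitz with velocities
   in [V]. If the sum of the two minima were positive for some proximal normal
   [p], upper semicontinuity of [V] would make [p . z] grow linearly along the
   solution [z], whereas [p . (z h - z 0) <= sigma |z h - z 0|^2 = O(h^2)].

   Sufficiency. Proximal aiming: at a point [z] with projection [s] on [S],
   the vector [z - s] is a proximal normal, so some velocity [v] at [s]
   satisfies [v . (z - s) <= 0]. An Euler step with [v] increases the squared
   distance to [S] by [O(h^2)] only, so the polygons converge, along an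
   ultrafilter on the step sizes, to a Lipschitz curve in [S]. Its difference
   quotients are controlled by the support function of [V], which is upper
   semicontinuous with closed convex values, so its almost everywhere existing
   derivative lies in [V]. *)

Require Import Defs.
From HB Require Import structures.
From mathcomp Require Import all_boot all_order all_algebra.
From mathcomp Require Import all_classical all_reals all_analysis.
From mathcomp Require Import measurable_realfun.
From mathcomp Require Import ring lra.

Import Order.TTheory GRing.Theory Num.Theory.
Import numFieldNormedType.Exports.

Set Implicit Arguments.
Unset Strict Implicit.
Unset Printing Implicit Defensive.

Local Open Scope classical_set_scope.
Local Open Scope ring_scope.

(** * Euclidean geometry of row vectors *)

Section Euclid.
Context {R : realType} {n : nat}.
Implicit Types (u v w : 'rV[R]_n) (a : R).

Lemma dotC u v : dot u v = dot v u.
Proof. by apply: eq_bigr => i _; rewrite mulrC. Qed.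

Lemma dotDl u v w : dot (u + v) w = dot u w + dot v w.
Proof. by rewrite -big_split/=; apply: eq_bigr => i _; rewrite mxE mulrDl. Qed.

Lemma dotZl a u w : dot (a *: u) w = a * dot u w.
Proof. by rewrite mulr_sumr; apply: eq_bigr => i _; rewrite mxE mulrA. Qed.

Lemma dotNl u w : dot (- u) w = - dot u w.
Proof. by rewrite -scaleN1r dotZl mulN1r. Qed.

Lemma dotBl u v w : dot (u - v) w = dot u w - dot v w.
Proof. by rewrite dotDl dotNl. Qed.

Lemma dotDr u v w : dot w (u + v) = dot w u + dot w v.
Proof. by rewrite dotC dotDl !(dotC w). Qed.

Lemma dotZr a u w : dot w (a *: u) = a * dot w u.
Proof. by rewrite dotC dotZl (dotC w). Qed.

Lemma dotNr u w : dot w (- u) = - dot w u.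
Proof. by rewrite dotC dotNl (dotC w). Qed.

Lemma dotBr u v w : dot w (u - v) = dot w u - dot w v.
Proof. by rewrite dotDr dotNr. Qed.

Lemma dot0l u : dot 0 u = 0.
Proof. by rewrite -(scale0r 0) dotZl mul0r. Qed.

Lemma dot0r u : dot u 0 = 0.
Proof. by rewrite dotC dot0l. Qed.

Lemma dot_ge0 u : 0 <= dot u u.
Proof. by apply: sumr_ge0 => i _; rewrite -expr2 sqr_ge0. Qed.

Lemma enorm_ge0 u : 0 <= enorm u.
Proof. exact: sqrtr_ge0. Qed.

Lemma enorm_sqr u : enorm u ^+ 2 = dot u u.
Proof. by rewrite sqr_sqrtr// dot_ge0. Qed.

Lemma coord_le_enorm u i : `|u 0 i| <= enorm u.
Proof.
rewrite -sqrtr_sqr ler_sqrt ?dot_ge0// /dot (bigD1 i)//= -expr2 lerDl.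
by apply: sumr_ge0 => j _; rewrite -expr2 sqr_ge0.
Qed.

Lemma enorm0 : enorm (0 : 'rV[R]_n) = 0.
Proof. by rewrite /enorm dot0l sqrtr0. Qed.

Lemma enorm_eq0 u : enorm u = 0 -> u = 0.
Proof.
move=> u0; apply/rowP => i; rewrite mxE; apply/eqP.
by rewrite -normr_le0 (le_trans (coord_le_enorm u i))// u0.
Qed.

Lemma enormN u : enorm (- u) = enorm u.
Proof. by rewrite /enorm dotNl dotNr opprK. Qed.

Lemma enorm_distC u v : enorm (u - v) = enorm (v - u).
Proof. by rewrite -enormN opprB. Qed.

(** Cauchy-Schwarz: for nonzero norms [a] and [b], the square of [enorm v *: u - enorm u *: v]
    expands to [2 * (a * b) * (a * b - d)], and it is nonnegative. *)
Lemma dot_le_enorm u v : dot u v <= enorm u * enorm v.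
Proof.
have [u0|u0] := eqVneq (enorm u) 0.
  by rewrite u0 mul0r (enorm_eq0 u0) dot0l.
have [v0|v0] := eqVneq (enorm v) 0.
  by rewrite v0 mulr0 (enorm_eq0 v0) dot0r.
have up : 0 < enorm u by rewrite lt_neqAle eq_sym u0 enorm_ge0.
have vp : 0 < enorm v by rewrite lt_neqAle eq_sym v0 enorm_ge0.
have := dot_ge0 (enorm v *: u - enorm u *: v).
rewrite !(dotBl, dotBr, dotZl, dotZr) -!enorm_sqr (dotC v u).
have uv : 0 < enorm u * enorm v by rewrite mulr_gt0.
move: (dot u v) (enorm u) (enorm v) up vp uv => d a b a0 b0 ab.
rewrite (_ : _ - _ = 2 * (a * b) * (a * b - d)); last by ring.
by rewrite pmulr_rge0 ?subr_ge0// mulr_gt0.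
Qed.

Lemma normr_dot_le u v : `|dot u v| <= enorm u * enorm v.
Proof.
by rewrite ler_norml dot_le_enorm andbT lerNl -dotNl (le_trans (dot_le_enorm _ _))// enormN.
Qed.

Lemma ler_enormD u v : enorm (u + v) <= enorm u + enorm v.
Proof.
rewrite -(@ler_pXn2r _ 2)// ?nnegrE ?addr_ge0 ?enorm_ge0//.
rewrite enorm_sqr !(dotDl, dotDr) -!enorm_sqr (dotC v u) sqrrD.
have := dot_le_enorm u v; lra.
Qed.

Lemma ler_enormB u v : enorm (u - v) <= enorm u + enorm v.
Proof. by rewrite -(enormN v) ler_enormD. Qed.

Lemma ler_enorm_dist w u v : enorm (u - v) <= enorm (u - w) + enorm (w - v).
Proof. by rewrite -[u - v](subrKA w) ler_enormD. Qed.

Lemma enormZ a u : enorm (a *: u) = `|a| * enorm u.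
Proof.
by rewrite /enorm dotZl dotZr mulrA -expr2 sqrtrM ?sqr_ge0// sqrtr_sqr.
Qed.

Lemma normr_le_enorm u : `|u| <= enorm u.
Proof.
rewrite [leLHS]/Num.Def.normr/= mx_normrE bigmax_le ?enorm_ge0// => -[i j] _ /=.
by rewrite (ord1 i) coord_le_enorm.
Qed.

Lemma enorm_le_normr u : enorm u <= n%:R * `|u|.
Proof.
rewrite -(@ler_pXn2r _ 2)// ?nnegrE ?enorm_ge0 ?mulr_ge0//.
have H i : u 0 i * u 0 i <= `|u| ^+ 2.
  rewrite -expr2 -real_normK ?num_real// lerXn2r// ?nnegrE//.
  rewrite [leRHS]/Num.Def.normr/= mx_normrE.
  exact: (le_bigmax _ (fun ij => `|u ij.1 ij.2|) (0, i)).
rewrite enorm_sqr /dot (@le_trans _ _ (\sum_(i < n) `|u| ^+ 2)) ?ler_sum//.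
rewrite sumr_const card_ord -[leLHS]mulr_natl exprMn ler_wpM2r ?sqr_ge0//.
rewrite expr2 -natrM ler_nat; case: (n) => [//|k]; exact: leq_pmulr.
Qed.

Lemma enorm_sqrD u v :
  enorm (u + v) ^+ 2 = enorm u ^+ 2 + 2 * dot v u + enorm v ^+ 2.
Proof. by rewrite !enorm_sqr !(dotDl, dotDr) (dotC u v); ring. Qed.

Lemma cvg_enormP (T : Type) (F : set_system T) {FF : Filter F}
    (f : T -> 'rV[R]_n) (l : 'rV[R]_n) :
  f @ F --> l <-> forall e, 0 < e -> \forall k \near F, enorm (l - f k) < e.
Proof.
split=> [/cvgrPdist_lt H e e0|H].
  (* The comparison constant of the two norms is [n]; [n.+1] keeps the quotient meaningful in
     dimension zero. *)
  have e1 : 0 < e / n.+1%:R by rewrite divr_gt0.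
  apply: filterS (H _ e1) => k lk; rewrite (le_lt_trans (enorm_le_normr _))//.
  rewrite (@le_lt_trans _ _ (n.+1%:R * `|l - f k|))//.
    by rewrite ler_wpM2r// ler_nat.
  by rewrite mulrC -ltr_pdivlMr.
apply/cvgrPdist_lt => e e0; apply: filterS (H e e0) => k.
exact/le_lt_trans/normr_le_enorm.
Qed.

Lemma closed_enormP (A : set 'rV[R]_n) :
  closed A <-> forall x, (forall e, 0 < e -> exists2 y, A y & enorm (x - y) < e) -> A x.
Proof.
split=> [cA x H|H x Ax].
  apply: cA => B /nbhs_ballP[e /= e0 eB].
  have [y Ay xy] := H _ e0; exists y; split => //; apply: eB.
  by rewrite -ball_normE/= (le_lt_trans (normr_le_enorm _)).
apply: H => e e0.
have e1 : 0 < e / n.+1%:R by rewrite divr_gt0.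
have [y [Ay]] := Ax _ (nbhsx_ballx x _ e1); rewrite -ball_normE/= => xy.
exists y => //; rewrite (le_lt_trans (enorm_le_normr _))//.
rewrite (@le_lt_trans _ _ (n.+1%:R * `|x - y|))//.
  by rewrite ler_wpM2r// ler_nat.
by rewrite mulrC -ltr_pdivlMr.
Qed.

Lemma cvg_dot (T : Type) (F : set_system T) {FF : Filter F}
    (f g : T -> 'rV[R]_n) (a b : 'rV[R]_n) :
  f @ F --> a -> g @ F --> b -> dot (f x) (g x) @[x --> F] --> dot a b.
Proof.
move=> fa gb; rewrite /dot; apply: cvg_big => //; first exact: add_continuous.
move=> i _; apply: cvgM.
  exact: (cvg_comp _ _ fa (@coord_continuous _ _ _ 0 i a)).
exact: (cvg_comp _ _ gb (@coord_continuous _ _ _ 0 i b)).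
Qed.

Lemma cvg_enorm (T : Type) (F : set_system T) {FF : Filter F}
    (f : T -> 'rV[R]_n) (a : 'rV[R]_n) :
  f @ F --> a -> enorm (f x) @[x --> F] --> enorm a.
Proof.
move=> fa; apply: (cvg_comp _ _ (cvg_dot fa fa)).
exact: sqrt_continuous.
Qed.

Lemma continuous_dotl (p : 'rV[R]_n) :
  continuous (fun v : 'rV[R]_n => dot v p).
Proof.
move=> x; have xp : (fun=> p) @ nbhs x --> p by exact: cvg_cst.
exact: (@cvg_dot _ _ _ id (fun=> p) x p _ xp).
Qed.

Lemma continuous_enorm_dist (z : 'rV[R]_n) : 
  continuous (fun y : 'rV[R]_n => enorm (z - y)).
Proof.
move=> y; have zy : (fun=> z) @ nbhs y --> z by exact: cvg_cst.
exact: (@cvg_enorm _ _ _ (fun y => z - y) _ (cvgB zy cvg_id)).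
Qed.

Lemma continuous_enorm : continuous (@enorm R n).
Proof. move=> y; exact: (@cvg_enorm _ (nbhs y) _ id y cvg_id). Qed.

Lemma bounded_closed_compact_enorm (A : set 'rV[R]_n) (B : R) :
  closed A -> (forall v, A v -> enorm v <= B) -> compact A.
Proof.
move=> cA AB; apply: bounded_closed_compact => //.
exists B; split; first exact: num_real.
move=> C BC v /AB vB; apply: (le_trans (normr_le_enorm v)).
exact: le_trans (ltW BC).
Qed.

Lemma dot_min_attained (A : set 'rV[R]_n) (B : R) (p : 'rV[R]_n) :
  closed A -> (forall v, A v -> enorm v <= B) -> A !=set0 ->
  exists2 a, A a & forall v, A v -> dot a p <= dot v p.
Proof.
move=> cA AB A0; have cptA := bounded_closed_compact_enorm cA AB.
have [|c /set_mem Ac H] := EVT_min_rV (f := fun v => dot v p) A0 cptA.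
  by apply: continuous_subspaceT; exact: continuous_dotl.
by exists c => // v /mem_set; exact: H.
Qed.

Lemma nearest_point (A : set 'rV[R]_n) (z : 'rV[R]_n) : closed A -> A !=set0 ->
  exists2 s, A s & forall y, A y -> enorm (z - s) <= enorm (z - y).
Proof.
(* Only points at least as close to [z] as [a] compete, and they form a compact set. *)
move=> cA [a Aa]; pose D := A `&` [set y | enorm (z - y) <= enorm (z - a)].
have cD : closed D.
  apply: closedI => //.
  have := @preimage_closed _ _ (fun y : 'rV[R]_n => enorm (z - y))
    [set r | r <= enorm (z - a)] _ (@num_normedtype.closed_le _ _).
  by apply => y _; exact: continuous_enorm_dist.
have Dc : compact D.
  apply: (@bounded_closed_compact_enorm _ (enorm z + enorm (z - a))) => //.
  move=> v [_ /= zv]; rewrite -[v](subrK z) addrC (le_trans (ler_enormD _ _))//.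
  by rewrite lerD2l (enorm_distC v).
have D0 : D !=set0 by exists a; split => /=.
have [|s /set_mem[As zs] H] := EVT_min_rV (f := fun y => enorm (z - y)) D0 Dc.
  apply: continuous_subspaceT; exact: continuous_enorm_dist.
exists s => // y Ay; have [yz|/ltW yz] := leP (enorm (z - y)) (enorm (z - a)).
  by apply: H; apply/mem_set; split.
exact: le_trans zs yz.
Qed.

(** Stands in for extracting subsequences: a single ultrafilter serves all bounded sequences at
    once. Compactness of the ball gives a cluster point, and a cluster point of an ultrafilter is a
    limit, since otherwise the ultrafilter would contain a set avoiding some neighbourhood of it. *)
Lemma ultra_bounded_cvg (U : set_system nat) (u : nat -> 'rV[R]_n) (B : R) :
  UltraFilter U -> (forall k, enorm (u k) <= B) ->
  exists l : 'rV[R]_n, u @ U --> l.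
Proof.
move=> UU uB.
have cB : compact [set v : 'rV[R]_n | enorm v <= B].
  apply: (@bounded_closed_compact_enorm _ B) => //.
  have := @preimage_closed _ _ (@enorm R n) [set r | r <= B] _ (@num_normedtype.closed_le _ _).
  by apply => y _; exact: continuous_enorm.
have [|l [_ ul]] := cB (u @ U).
  by apply: (@filterE _ U) => k; exact: uB.
exists l; apply/cvg_enormP => e e0.
have [//|nU] := in_ultra_setVsetC [set k | enorm (l - u k) < e] UU.
have nB : nbhs l [set v | enorm (l - v) < e].
  exact: ((@cvg_enormP _ (nbhs l) _ id l).1 cvg_id).
have Uim : (u @ U) (u @` (~` [set k | enorm (l - u k) < e])).
  by apply: (@filterS _ U _ _ _ _ nU) => k nk; exists k.
by have [v [[k nk <-] lv]] := ul _ _ Uim nB; case: (nk lv).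
Qed.

End Euclid.

(** * Time-space vectors and their Euclidean norm *)

Section TimeSpace.
Context {R : realType} {n : nat}.
Implicit Types (s t : R) (x y : 'rV[R]_n).

Lemma dot_tx s t x y : dot (tx s x) (tx t y) = s * t + dot x y.
Proof.
rewrite /dot big_split_ord/= big_ord1 /tx; congr (_ + _).
  by rewrite !row_mxEl !mxE eqxx !mulr1n.
by apply: eq_bigr => i _; rewrite !row_mxEr.
Qed.

Lemma tx_surj (p : 'rV[R]_(1 + n)) : exists s x, p = tx s x.
Proof.
exists (lsubmx p 0 0), (rsubmx p); rewrite /tx -mx11_scalar hsubmxK//.
Qed.

Lemma tx_inj s t x y : tx s x = tx t y -> s = t /\ x = y.
Proof.
by move=> /eq_row_mx[/(congr1 (fun M : 'M[R]_1 => M 0 0))]; rewrite !mxE eqxx !mulr1n.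
Qed.

Lemma txB s t x y : tx s x - tx t y = tx (s - t) (x - y).
Proof. by rewrite /tx opp_row_mx add_row_mx -raddfB. Qed.

Lemma txD s t x y : tx s x + tx t y = tx (s + t) (x + y).
Proof. by rewrite /tx add_row_mx -raddfD. Qed.

Lemma enorm_tx_sqr s x : enorm (tx s x) ^+ 2 = s ^+ 2 + enorm x ^+ 2.
Proof. by rewrite !enorm_sqr dot_tx expr2. Qed.

Lemma enorm_tx_le s x : enorm (tx s x) <= `|s| + enorm x.
Proof.
rewrite -(@ler_pXn2r _ 2)// ?nnegrE ?addr_ge0 ?enorm_ge0//.
rewrite enorm_tx_sqr sqrrD real_normK ?num_real// lerD2r lerDl.
by rewrite mulrn_wge0// mulr_ge0// enorm_ge0.
Qed.

Lemma normr_le_enorm_tx s x : `|s| <= enorm (tx s x).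
Proof.
rewrite -(@ler_pXn2r _ 2)// ?nnegrE ?enorm_ge0//.
by rewrite enorm_tx_sqr real_normK ?num_real// lerDl sqr_ge0.
Qed.

Lemma enorm_le_enorm_tx s x : enorm x <= enorm (tx s x).
Proof.
rewrite -(@ler_pXn2r _ 2)// ?nnegrE ?enorm_ge0//.
by rewrite enorm_tx_sqr lerDr sqr_ge0.
Qed.

End TimeSpace.

(** * Lipschitz functions are differentiable almost everywhere *)

Section LipschitzAE.
Context {R : realType}.
Local Notation mu := (@lebesgue_measure R).
Local Open Scope ereal_scope.

Lemma nondecreasing_lipschitz_cumulative (g : R -> R) (c : R) :
  (forall x y, x <= y -> g x <= g y)%R ->
  (forall x y, `|g x - g y| <= c * `|x - y|)%R ->
  exists h : cumulative R R, forall x, h x = g x.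
Proof.
move=> ndg lipg.
have c_ge0 : (0 <= c)%R.
  by have := lipg 1%R 0%R; rewrite subr0 normr1 mulr1; exact: le_trans.
have cg : right_continuous g.
  apply: right_continuousW => x.
  have c1 : (0 < c + 1)%R by rewrite ltr_wpDl.
  apply/cvgrPdist_le => e e0; near=> y.
  apply: (le_trans (lipg x y)).
  apply: (@le_trans _ _ ((c + 1) * (e / (c + 1)))%R); last first.
    by rewrite mulrC divfK// gt_eqF.
  apply: ler_pM => //; first by rewrite lerDl.
  near: y; apply: (@cvgr_dist_le _ _ _ _ _ id x); first exact: cvg_id.
  exact: divr_gt0.
pose M := isCumulative.Build R _ R g ndg cg.
pose h : cumulative R R := HB.pack g M.
by exists h.
Unshelve. all: by end_near. Qed.

Lemma lebesgue_stieltjes_itvoc (h : cumulative R R) (a b : R) : (a <= b)%R ->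
  lebesgue_stieltjes_measure h `]a, b]%classic = (h b - h a)%:E.
Proof.
move=> ab.
rewrite /lebesgue_stieltjes_measure/= /measure_extension/=.
rewrite measurable_mu_extE/=; last exact: is_ocitv.
by rewrite wlength_itv_bnd.
Qed.

(* If [h + k] is [C * id] then the Stieltjes measures of [h] and [k] add up to
   [C] times the Lebesgue measure, so each of them is dominated by it. *)
Lemma lebesgue_stieltjes_null (h k : cumulative R R) (C : R) :
  (forall x, h x + k x = C * x)%R -> (0 <= C)%R ->
  forall A, measurable A -> mu A = 0 -> lebesgue_stieltjes_measure h A = 0.
Proof.
move=> hk C0 A mA A0.
have [l lE] : exists l : cumulative R R, forall x, l x = (C * x)%R.
  apply: (@nondecreasing_lipschitz_cumulative _ C) => x y.
    by move=> xy; exact: ler_wpM2l.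
  by rewrite -mulrBr normrM (ger0_norm C0).
have l1 X : ocitv X -> lebesgue_stieltjes_measure l X =
    measure_add (lebesgue_stieltjes_measure h) (lebesgue_stieltjes_measure k) X.
  move=> /ocitvP[->|[[u v] /= uv ->]]; first by rewrite !measure0.
  rewrite measure_addE [LHS](lebesgue_stieltjes_itvoc _ (ltW uv)).
  rewrite [X in _ = X + _](lebesgue_stieltjes_itvoc _ (ltW uv)).
  rewrite [X in _ = _ + X](lebesgue_stieltjes_itvoc _ (ltW uv)).
  rewrite -EFinD !lE -!hk; congr EFin; ring.
have l2 X : ocitv X -> lebesgue_stieltjes_measure l X =
    mscale (NngNum C0) mu X.
  move=> /ocitvP[->|[[u v] /= uv ->]]; first by rewrite !measure0.
  rewrite /mscale/= [LHS](lebesgue_stieltjes_itvoc _ (ltW uv)).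
  rewrite [X in _ = _ * X](lebesgue_stieltjes_itvoc _ (ltW uv)) -EFinM !lE /=.
  congr EFin; ring.
have E1 : lebesgue_stieltjes_measure l A =
    measure_add (lebesgue_stieltjes_measure h) (lebesgue_stieltjes_measure k) A.
  exact: lebesgue_stieltjes_measure_unique l1 _ mA.
have E2 : lebesgue_stieltjes_measure l A = C%:E * mu A.
  exact: lebesgue_stieltjes_measure_unique l2 _ mA.
move: E2; rewrite E1 measure_addE A0 mule0 => /eqP.
by rewrite padde_eq0 ?measure_ge0// => /andP[/eqP].
Qed.

(** Adding [c * x] makes [f] nondecreasing. The Stieltjes measure of the sum is dominated by
    Lebesgue measure, so it has a density [q], and at the Lebesgue points of [q] the sum is
    differentiable as an indefinite integral of [q]. *)
Lemma lipschitz_ae_derivable (f : R -> R) (c a b : R) : (0 < c)%R ->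
  (forall x y, `|f x - f y| <= c * `|x - y|)%R ->
  {ae mu, forall x, (a < x < b)%R -> derivable f x 1%R}.
Proof.
move=> c0 lipf.
have lipf' x y : (x <= y)%R -> (`|f x - f y| <= c * (y - x))%R.
  by move=> xy; rewrite distrC -[X in (_ <= c * X)%R]ger0_norm ?subr_ge0//.
have [h hE] : exists h : cumulative R R, forall x, h x = (c * x + f x)%R.
  apply: (@nondecreasing_lipschitz_cumulative _ (c + c)%R).
    by move=> x y xy; have := lipf' _ _ xy; rewrite ler_norml; lra.
  move=> x y; rewrite (_ : (_ - _ = c * (x - y) + (f x - f y))%R); last by ring.
  rewrite (le_trans (ler_normD _ _))// mulrDl lerD//.
  by rewrite normrM gtr0_norm.
have [k kE] : exists h : cumulative R R, forall x, h x = (c * x - f x)%R.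
  apply: (@nondecreasing_lipschitz_cumulative _ (c + c)%R).
    by move=> x y xy; have := lipf' _ _ xy; rewrite ler_norml; lra.
  move=> x y; rewrite (_ : (_ - _ = c * (x - y) - (f x - f y))%R); last by ring.
  rewrite (le_trans (ler_normB _ _))// mulrDl lerD//.
  by rewrite normrM gtr0_norm.
have dom : forall A, measurable A -> mu A = 0 ->
    lebesgue_stieltjes_measure h A = 0.
  apply: (@lebesgue_stieltjes_null h k (c + c)%R).
    by move=> x; rewrite hE kE; ring.
  by rewrite addr_ge0// ltW.
have [ba|ab] := leP b a.
  apply: aeW => x /= /andP[ax xb]; exfalso.
  by have := lt_trans ax xb; rewrite ltNge ba.
have mI : measurable (`]a, b]%classic : set (measurableTypeR R)) by exact: measurable_itv.
have fI : lebesgue_stieltjes_measure h `]a, b]%classic < +oo.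
  by rewrite lebesgue_stieltjes_itvoc ?ltry// ltW.
(* Restricting to a bounded interval makes the measure finite, hence its density integrable. *)
pose nu : {finite_measure set _ -> \bar R} := mfrestr mI fI.
have nudom : nu `<< mu.
  apply/null_content_dominatesP => A mA A0.
  rewrite /nu/= /mfrestr /mrestr.
  apply: dom; first exact: measurableI.
  by apply: (subset_measure0 _ _ _ A0) => //; exact: measurableI.
have [p [p0 pfin pint pE]] := @radon_nikodym_sigma_finite _ _ _ mu nu nudom.
pose q : R -> R := fine \o p.
have qp : EFin \o q = p by apply/funext => x; rewrite /q/= fineK.
have qint : mu.-integrable setT (EFin \o q) by rewrite qp.
have locq : locally_integrable setT q.
  by apply: open_integrable_locally => //; exact: openT.
move: (locq) => /lebesgue_differentiation.
apply: filterS; first exact: (ae_filter_ringOfSetsType mu).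
move=> x qx /andP[ax xb].
have qI : mu.-integrable [set` Interval (BRight a) (BRight b)] (EFin \o q).
  exact: integrableS qint.
have := FTC1_lebesgue_pt xb qI => /(_ _ qx) [|dF _]; first by [].
(* Inside the interval, the indefinite integral of the density is [f] up to an affine function. *)
have FE y : (a < y < b)%R ->
  (\int[mu]_(t in [set` Interval (BRight a) (BRight y)]) q t)%R =
  (c * y + f y - (c * a + f a))%R.
  move=> /andP[ay yb]; rewrite /Rintegral.
  have -> : \int[mu]_(t in [set` Interval (BRight a) (BRight y)]) (q t)%:E =
     nu [set` Interval (BRight a) (BRight y)].
    by rewrite pE// -qp.
  rewrite /nu/= /mfrestr /mrestr setIidl; last first.
    by apply: subset_itvl; rewrite bnd_simp ltW.
  by rewrite lebesgue_stieltjes_itvoc ?ltW//= !hE.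
have nx : \forall y \near x, (a < y < b)%R.
  have : x \in `]a, b[%R by rewrite in_itv/= ax.
  by move=> /near_in_itvoo; apply: filterS => y; rewrite in_itv.
have {}dF : derivable (fun y => c * y + f y - (c * a + f a))%R x 1%R.
  apply: near_eq_derivable dF.
  by near=> y; apply: FE; near: y.
have -> : f = (fun y => (c * y + f y - (c * a + f a)) - (c * y - (c * a + f a)))%R.
  by apply/funext => y; ring.
apply: derivableB => //; apply: derivableB => //.
Unshelve. all: by end_near. Qed.

End LipschitzAE.

(** * Growth of absolutely continuous functions *)

Lemma derivable_expansion (R : realType) (f : R -> R) (s e : R) :
  derivable f s 1 -> 0 < e ->
  exists2 d, 0 < d & forall y, `|y - s| < d ->
    `|f y - f s - derive1 f s * (y - s)| <= e * `|y - s|.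
Proof.
move=> fs e0.
have : (fun h => h^-1 *: (f (h *: 1 + s) - f s)) @ 0^' --> derive1 f s.
  by rewrite derive1E; exact: fs.
move=> /cvgrPdist_le /(_ _ e0) [d /= d0 H].
exists d => // y yd.
have [->|ys] := eqVneq y s; first by rewrite !subrr mulr0 subrr normr0 mulr0.
have ys0 : y - s != 0 by rewrite subr_eq0.
have := H (y - s); rewrite /= sub0r normrN => /(_ yd ys0).
rewrite [(y - s) *: 1]mulr1 subrK => H1.
rewrite (_ : f y - f s - _ = - ((y - s) *
   (derive1 f s - (y - s)^-1 *: (f y - f s)))); last first.
  by rewrite [in RHS]mulrBr -[_ *: _]/((y - s)^-1 * (f y - f s)) mulVKf// opprB mulrC.
by rewrite normrN normrM mulrC ler_wpM2r.
Qed.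

Definition scalar_ac (R : realType) (T : R) (f : R -> R) : Prop :=
  forall e : R, 0 < e -> exists2 d : R, 0 < d &
    forall (k : nat) (u v : 'I_k -> R),
      (forall i, 0 <= u i /\ u i <= v i /\ v i <= T) ->
      trivIset [set: 'I_k] (fun i => `]u i, v i[%classic) ->
      \sum_(i < k) (v i - u i) < d ->
      \sum_(i < k) `|f (v i) - f (u i)| < e.

Section AcGrowth.
Context {R : realType}.
Local Notation mu := (@lebesgue_measure R).
Implicit Types f : R -> R.

(* The increment of [f] over [0, s] is at least [(c - e) s], up to the variation
   of [f] over finitely many disjoint intervals whose lengths add up to at most
   the measure of [U] below [s]; the null set of bad points will lie in [U]. *)
Let reach f (U : set R) (c e s : R) : Prop :=
  exists k (u v : nat -> R),
    [/\ forall i, (i < k)%N -> 0 <= u i /\ u i <= v i /\ v i <= s,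
        forall i j, (i < j)%N -> (j < k)%N -> v i <= u j,
        \sum_(i < k) (v i - u i) <= fine (mu (U `&` `]0, s])) &
        (c - e) * s - `|c| * fine (mu (U `&` `]0, s])) -
          \sum_(i < k) `|f (v i) - f (u i)| <= f s - f 0].

Section Steps.
Variables (f : R -> R) (U : set R) (c e : R).
Hypotheses (oU : open U) (U_fin : (mu U < +oo)%E).

Let mU : measurable (U : set (measurableTypeR R)).
Proof. exact: open_measurable. Qed.

Let mUI (I : interval R) :
  measurable (U `&` [set` I] : set (measurableTypeR R)).
Proof. by apply: measurableI => //; exact: measurable_itv. Qed.

Let UI_fin (I : interval R) : mu (U `&` [set` I]) \is a fin_num.
Proof.
rewrite ge0_fin_numE ?measure_ge0//; apply: le_lt_trans U_fin.
by apply: le_measure; rewrite ?inE//; exact: subIsetl.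
Qed.

Let phi_mono (s s' : R) : s <= s' ->
  fine (mu (U `&` `]0, s])) <= fine (mu (U `&` `]0, s'])).
Proof.
move=> ss'; apply: fine_le => //; apply: le_measure; rewrite ?inE//.
by apply: setIS; apply: subset_itvl; rewrite bnd_simp.
Qed.

(** Used for bad steps: an interval inside [U] is charged its full length. *)
Let phi_add (s s' : R) : 0 <= s -> s <= s' -> `]s, s']%classic `<=` U ->
  fine (mu (U `&` `]0, s'])) = fine (mu (U `&` `]0, s])) + (s' - s).
Proof.
move=> s0 ss' sU.
have -> : U `&` `]0, s']%classic = (U `&` `]0, s]) `|` `]s, s'].
  rewrite -(@setIidr _ U `]s, s']%classic)// -setIUr; congr (_ `&` _).
  by rewrite -itv_bndbnd_setU// bnd_simp.
rewrite measureU//; last first.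
  apply/seteqP; split => // x [[_ /=]]; rewrite !in_itv/= => /andP[_ xs].
    by rewrite ltNge xs.
have mss : mu `]s, s']%classic = (s' - s)%:E.
  rewrite lebesgue_measure_itv/= lte_fin; case: ltP => // s's.
  by congr EFin; apply/esym/eqP; rewrite subr_eq0 eq_le s's.
transitivity (fine (adde (mu (U `&` `]0, s])) (s' - s)%:E)); first by rewrite -mss.
by rewrite fineD.
Qed.

Lemma reach0 : reach f U c e 0.
Proof.
exists 0%N, (fun=> 0), (fun=> 0); split => //.
  by rewrite big_ord0 fine_ge0// measure_ge0.
rewrite big_ord0 mulr0 !subrr sub0r subr0 oppr_le0 mulr_ge0//.
by rewrite fine_ge0// measure_ge0.
Qed.

Lemma reach_good (s s' : R) : s <= s' -> (c - e) * (s' - s) <= f s' - f s ->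
  reach f U c e s -> reach f U c e s'.
Proof.
move=> ss' fss' [k [u [v [H1 H2 H3 H4]]]]; exists k, u, v.
have phi := phi_mono ss'.
split => //.
- move=> i /H1[? [? ?]]; split => //; split => //; exact: le_trans ss'.
- exact: le_trans phi.
- have : `|c| * fine (mu (U `&` `]0, s])) <= `|c| * fine (mu (U `&` `]0, s'])).
    by rewrite ler_wpM2l.
  by move: H4 fss'; rewrite mulrBr; lra.
Qed.

(** The interval from [s] to [s'] is appended to the list. Its variation term covers a possible
    decrease of [f], and the growth of the measure term, weighted by |c|, covers the increment
    [c * (s' - s)] that is asked for. *)
Lemma reach_bad (s s' : R) : 0 <= e -> 0 <= s -> s <= s' ->
  `]s, s']%classic `<=` U -> reach f U c e s -> reach f U c e s'.
Proof.
move=> e0 s0 ss' sU [k [u [v [H1 H2 H3 H4]]]].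
have phi := phi_add s0 ss' sU.
exists k.+1, (fun i => if i == k then s else u i),
  (fun i => if i == k then s' else v i).
have vk (F : R -> R -> R) : \sum_(i < k) F (if i == k :> nat then s' else v i)
   (if i == k :> nat then s else u i) = \sum_(i < k) F (v i) (u i).
  by apply: eq_bigr => i _; rewrite ltn_eqF.
split.
- move=> i; rewrite ltnS leq_eqVlt; case: eqP => [_ _|_ /= /H1[? [? vs]]] //.
  by split => //; split => //; exact: le_trans ss'.
- move=> i j ij; rewrite ltnS leq_eqVlt; case: eqP => [jk _|_ /= jk].
    rewrite ifF; last by apply/negbTE; rewrite -jk ltn_eqF.
    by have [|_ []] := H1 i; rewrite -?jk.
  by rewrite ifF; [exact: H2|rewrite ltn_eqF// (ltn_trans ij)].
- rewrite big_ord_recr/= eqxx (vk (fun x y => x - y)) phi.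
  by rewrite lerD2r.
- rewrite big_ord_recr/= eqxx (vk (fun x y => `|f x - f y|)) phi.
  have : - `|f s' - f s| <= f s' - f s by rewrite lerNl -normrN ler_norm.
  have : c * (s' - s) <= `|c| * (s' - s) by rewrite ler_wpM2r ?ler_norm ?subr_ge0.
  have : 0 <= e * (s' - s) by rewrite mulr_ge0 ?subr_ge0.
  move: H4; rewrite !(mulrDr, mulrDl, mulrN, mulNr).
  set X := `|c| * fine _; set S := \sum_(i < k) _.
  set c1 := `|c| * s; set c2 := `|c| * s'; set F := `|_|.
  lra.
Qed.

End Steps.

(** Continuous induction on the points satisfying [reach]. The exceptional null set is enclosed in a
    small open [U]. At the supremum of the reachable points one can always step further: by
    [reach_bad] if it lies in [U], and otherwise by [reach_good], since there the derivative is at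
    least [c]. At [h], absolute continuity makes the accumulated variation small. *)
Lemma ac_derive_ge (f : R -> R) (T c : R) : scalar_ac T f ->
  {ae mu, forall t, 0 <= t <= T -> derivable f t 1 /\ c <= derive1 f t} ->
  forall h, 0 <= h <= T -> c * h <= f h - f 0.
Proof.
move=> acf [A [mA A0 NA]] h /andP[h0 hT].
(* The total error is [e] times [K], so the claim is applied to [e / K]. *)
suff H e : 0 < e -> (c - e) * h - `|c| * e - e <= f h - f 0.
  apply/ler_addgt0Pr => e e0.
  pose K := h + `|c| + 1.
  have K0 : 0 < K by rewrite ltr_pwDr// addr_ge0.
  have := H (e / K); rewrite divr_gt0// => /(_ isT).
  have : e / K * K = e by rewrite divfK// gt_eqF.
  by rewrite /K; set E := e / _; move=> <-; set C := `|c|; lra.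
move=> e0.
have [d d0 acfd] := acf e e0.
(* The bound [d] on the measure of [U] controls the variation over the bad intervals, the bound [e]
   controls the term weighted by |c|. *)
have de0 : 0 < Num.min d e by rewrite lt_min d0.
have Afin : (mu A < +oo)%E by rewrite [X in (X < _)%E]A0.
have [U [oU AU UA]] := lebesgue_regularity_outer mA Afin de0.
have mUr : measurable (U : set (measurableTypeR R)) by exact: open_measurable.
have Ud : (mu U < (Num.min d e)%:E)%E.
  rewrite -(setDKU AU) setUC measureU//.
  - by rewrite [X in (X + _)%E]A0 add0e.
  - exact: measurableD.
  - by rewrite setDIK.
have Ufin : (mu U < +oo)%E by exact: lt_trans Ud (ltry _).
have mUI s : measurable (U `&` `]0, s] : set (measurableTypeR R)).
  by apply: measurableI => //; exact: measurable_itv.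
have leUI s : (mu (U `&` `]0%R, s]) <= mu U)%E.
  by apply: le_measure; [rewrite inE; exact: mUI|rewrite inE|exact: subIsetl].
have phi_le s : fine (mu (U `&` `]0, s])) < Num.min d e.
  rewrite -lte_fin fineK; first exact: le_lt_trans Ud.
  by rewrite ge0_fin_numE ?measure_ge0//; exact: le_lt_trans Ufin.
suff : reach f U c e h.
  move=> [k [u [v [H1 H2 H3 H4]]]].
  have S1 : \sum_(i < k) `|f (v i) - f (u i)| < e.
    apply: acfd.
    - by move=> i; have [? [? vh]] := H1 i (ltn_ord i); split => //; split => //;
        exact: le_trans hT.
    - apply/trivIsetP => i j _ _; wlog ij : i j / (i < j)%N.
        move=> H ij; have := ij; rewrite neq_ltn => /orP[|] ij'.
          exact: H.
        by rewrite setIC; apply: H => //; rewrite eq_sym.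
      move=> _; apply/seteqP; split => // x [] /=; rewrite !in_itv/=.
      move=> /andP[_ xv] /andP[ux _].
      have := lt_le_trans xv (H2 _ _ ij (ltn_ord j)).
      by move=> /(lt_trans ux); rewrite ltxx.
    - by apply: (le_lt_trans H3); have := phi_le h; rewrite lt_min => /andP[].
  have : `|c| * fine (mu (U `&` `]0, h])) <= `|c| * e.
    rewrite ler_wpM2l// ltW//.
    by have := phi_le h; rewrite lt_min => /andP[].
  move: S1 H4; set S := \sum_(i < k) _; set X := `|c| * fine _.
  by set Y := `|c| * e; lra.
pose E := [set s | 0 <= s <= h /\ reach f U c e s].
have E0 : E 0 by split; [rewrite lexx|exact: reach0].
have hsE : has_sup E.
  split; first by exists 0.
  by exists h => s [/andP[]].
have sE0 : 0 <= sup E by apply: ub_le_sup => //; exact: hsE.2.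
have sEh : sup E <= h.
  by apply: ge_sup; [exists 0|move=> s [/andP[]]].
(* Within radius [y] of the supremum, reachability passes from any point on its left to any point on
   its right. *)
have [y y0 Hy] : exists2 y, 0 < y & forall s s', 0 <= s -> s <= sup E ->
    sup E <= s' -> sup E - y < s -> s' < sup E + y ->
    reach f U c e s -> reach f U c e s'.
  have [UE|nUE] := pselect (U (sup E)).
    have /nbhs_ballP[y /= y0 yU] : nbhs (sup E) U by exact: open_nbhs_nbhs.
    exists y => // s s' s0 s1 s2 s3 s4; apply: (reach_bad oU Ufin (ltW e0)) => //.
      exact: le_trans s2.
    move=> x /=; rewrite in_itv/= => /andP[sx xs']; apply: yU.
    by rewrite /ball/= ltr_distlC; apply/andP; split; lra.
  have [dE cE] : derivable f (sup E) 1 /\ c <= derive1 f (sup E).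
    apply: contrapT => nH; apply: nUE; apply: AU; apply: NA => /= H.
    by apply: nH; apply: H; rewrite sE0 (le_trans sEh).
  have [y y0 Hy] := derivable_expansion dE e0.
  exists y => // s s' s0 s1 s2 s3 s4; apply: (reach_good oU Ufin).
    exact: le_trans s2.
  have := Hy s; have := Hy s'; rewrite [`|s - _|]distrC.
  rewrite (@ger0_norm _ (s' - _)) ?subr_ge0// (@ger0_norm _ (_ - s)) ?subr_ge0//.
  have -> : s' - sup E < y by lra.
  have -> : sup E - s < y by lra.
  move=> /(_ isT) + /(_ isT); rewrite !ler_norml => /andP[A1 _] /andP[_ A2].
  have : c * (s' - sup E) <= derive1 f (sup E) * (s' - sup E).
    by rewrite ler_wpM2r// subr_ge0.
  have : c * (sup E - s) <= derive1 f (sup E) * (sup E - s).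
    by rewrite ler_wpM2r// subr_ge0.
  by move: A1 A2; rewrite !(mulrDr, mulrDl, mulrN, mulNr); lra.
have [s [/andP[s0 sh] Ps] sy] : exists2 s, E s & sup E - y < s.
  exact: sup_adherent.
have ss : s <= sup E by apply: ub_le_sup; [exact: hsE.2|split => //; rewrite s0].
(* This point is reachable, hence not beyond [sup E]; the minimum must therefore be [h]. *)
pose s' := Num.min (sup E + y / 2) h.
have ss' : sup E <= s' by rewrite le_min sEh lerDl divr_ge0// ltW.
have s'h : s' <= h by rewrite ge_min lexx orbT.
have Es' : E s'.
  split; first by rewrite s'h (le_trans sE0).
  apply: (Hy s) => //; rewrite gt_min; apply/orP; left; lra.
have : s' <= sup E by apply: ub_le_sup => //; exact: hsE.2.
rewrite ge_min => /orP[|hE]; first by lra.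
suff <- : s' = h by exact: Es'.2.
by apply/eqP; rewrite eq_le s'h (le_trans hE).
Qed.

End AcGrowth.

(** * Proximal normals and admissible velocities *)

(** As [B] is closed, the infimum defining the distance is attained, so the bound [c] holds without
    any slack. *)
Lemma hausdorff_dist_le_nearest (R : realType) (n : nat) (A B : set 'rV[R]_n) (c : R) a :
  closed B -> B !=set0 -> (hausdorff_dist A B <= c%:E)%E -> A a ->
  exists2 b, B b & enorm (a - b) <= c.
Proof.
move=> cB B0 ABc Aa; have [b Bb bmin] := nearest_point a cB B0.
exists b => //.
have : (dist_to_set a B <= c%:E)%E.
  apply: le_trans ABc; rewrite /hausdorff_dist le_max; apply/orP; left.
  by apply: ereal_sup_ubound; exists a.
rewrite -lee_fin; apply: le_trans.
by apply: le_ereal_inf_tmp => _ [y By <-]; rewrite lee_fin bmin.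
Qed.

Section ProximalNormal.
Context {R : realType} {n : nat}.
Implicit Types (A : set 'rV[R]_n) (x y z : 'rV[R]_n).

Lemma proximal_normal0 A x : A x -> proximal_normal A x 0.
Proof.
by move=> Ax; split => //; exists 0; split => // y _; rewrite dot0l mul0r.
Qed.

Lemma proximal_normal_conic A x z1 z2 (a b : R) : 0 <= a -> 0 <= b ->
  proximal_normal A x z1 -> proximal_normal A x z2 ->
  proximal_normal A x (a *: z1 + b *: z2).
Proof.
move=> a0 b0 [Ax [s1 [s10 H1]]] [_ [s2 [s20 H2]]]; split => //.
exists (a * s1 + b * s2); split; first by rewrite addr_ge0// mulr_ge0.
move=> y Ay; rewrite dotDl !dotZl mulrDl -!mulrA.
by rewrite lerD// ler_wpM2l// ?H1 ?H2.
Qed.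

(** Expanding the squares of the norms of [z - s] and of [z - y = (z - s) - (y - s)] gives the
    normal inequality with constant one half. *)
Lemma proximal_normal_nearest A z s : A s ->
  (forall y, A y -> enorm (z - s) <= enorm (z - y)) ->
  proximal_normal A s (z - s).
Proof.
move=> As smin; split => //; exists (2^-1); split; first by rewrite invr_ge0.
move=> y Ay.
have : enorm (z - s) ^+ 2 <= enorm (z - y) ^+ 2.
  by rewrite lerXn2r ?nnegrE ?enorm_ge0 ?smin.
rewrite (_ : z - y = (z - s) - (y - s)); last by rewrite opprB addrA subrK.
rewrite !enorm_sqr !(dotBl (z - s)) !(dotBr (z - s)) (dotC (y - s) (z - s)).
rewrite mulrC; lra.
Qed.

(** The constant [sigma], which may depend on the normal, is replaced by one that is continuous in
    [z] and uniform over the sets sharing [r]; in this form normality survives limits. *)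
Lemma prox_regular_normalP A (r : R) x z : 0 < r -> prox_regular r A ->
  proximal_normal A x z <->
  A x /\ forall y, A y -> dot z (y - x) <= (2 * r)^-1 * enorm z * enorm (y - x) ^+ 2.
Proof.
move=> r0 [_ prA]; split=> [Nz|[Ax H]].
  by split=> [|y Ay]; [exact: Nz.1|apply: prA => //; exact: Nz.1].
split => //; exists ((2 * r)^-1 * enorm z); split => //.
by rewrite mulr_ge0 ?enorm_ge0// invr_ge0 mulr_ge0// ltW.
Qed.

End ProximalNormal.

Definition velocity (R : realType) (n : nat) (C : R -> set 'rV[R]_n)
    (G : R -> 'rV[R]_n -> set 'rV[R]_n) (B t : R) (x : 'rV[R]_n) : set 'rV[R]_n :=
  [set - zeta + g | zeta in proximal_normal (C t) x `&` eball B & g in G t x].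

(** * Closedness and semicontinuity properties of the moving set, its normals and the admissible
    velocities *)

Section MovingSet.
Context {R : realType} {n : nat}.
Variables (C : R -> set 'rV[R]_n) (G : R -> 'rV[R]_n -> set 'rV[R]_n).
Variables (L_C M L_G : R).
Hypotheses (hC : HC C L_C) (hG : HG G M L_G).
Implicit Types (s t : R) (x y : 'rV[R]_n).

Lemma HC_closed t : 0 <= t -> closed (C t).
Proof. by move=> t0; have [r _ /(_ _ t0)[]] := HC_prox hC. Qed.

Lemma HC_select t s x : 0 <= t -> 0 <= s -> C t x ->
  exists2 y, C s y & enorm (x - y) <= L_C * `|t - s|.
Proof.
move=> t0 s0; apply: hausdorff_dist_le_nearest.
- exact: HC_closed.
- exact: (HC_nonempty hC).
- exact: (HC_lipschitz hC).
Qed.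

Lemma HG_select t s x y v : 0 <= t -> 0 <= s -> G t x v ->
  exists2 w, G s y w & enorm (v - w) <= L_G * enorm (tx t x - tx s y).
Proof.
move=> t0 s0; apply: hausdorff_dist_le_nearest.
- exact: (HG_closed hG).
- exact: (HG_nonempty hG).
- exact: (HG_lipschitz hG).
Qed.

Lemma HC_constant_ge0 : 0 <= L_C.
Proof.
have [x Cx] := HC_nonempty hC (lexx 0).
have [y _] := HC_select (lexx 0) ler01 Cx.
by rewrite sub0r normrN1 mulr1; apply: le_trans; exact: enorm_ge0.
Qed.

Lemma HG_bound_ge0 : 0 <= M.
Proof.
have [v /(HG_bounded hG (lexx 0))] := HG_nonempty hG (0 : 'rV_n) (lexx 0).
by apply: le_trans; exact: enorm_ge0.
Qed.

(** Each [x_ k] can be moved into [C t] at cost [L_C] times the time difference, so [x] is a limit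
    of points of the closed set [C t]. *)
Lemma HC_graph_closed (F : set_system nat) {FF : ProperFilter F}
    (t_ : nat -> R) (x_ : nat -> 'rV[R]_n) t x :
  (forall k, 0 <= t_ k) -> (forall k, C (t_ k) (x_ k)) ->
  t_ @ F --> t -> x_ @ F --> x -> 0 <= t /\ C t x.
Proof.
move=> t_0 Cx tt xx.
have t0 : 0 <= t.
  by apply: (@closed_cvg _ _ F _ _ _ (@num_normedtype.closed_ge R 0) _ _ tt);
    exact: nearW.
split => //; apply/(closed_enormP _).1; first exact: HC_closed.
move=> e e0.
have e1 : 0 < e / 2 / (L_C + 1) by rewrite !divr_gt0// ltr_wpDl// HC_constant_ge0.
have e2 : 0 < e / 2 by rewrite divr_gt0.
have H1 : \forall k \near F, `|t - t_ k| < e / 2 / (L_C + 1).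
  by move/cvgrPdist_lt : tt; exact.
have H2 : \forall k \near F, enorm (x - x_ k) < e / 2.
  by move/cvg_enormP : xx; exact.
have [k [tk xk]] := filter_ex (filterI H1 H2).
have [y Cy xy] := HC_select (t_0 k) t0 (Cx k).
exists y => //; rewrite (le_lt_trans (ler_enorm_dist (x_ k) _ _))//.
rewrite [ltRHS]splitr ltr_leD//; apply: (le_trans xy).
rewrite distrC (@le_trans _ _ ((L_C + 1) * `|t - t_ k|))//.
  by rewrite ler_wpM2r// lerDl.
by rewrite mulrC -ler_pdivlMr ?ltW// ltr_wpDl// HC_constant_ge0.
Qed.

(** Every test point [y] of [C t] is a limit of points [y_ k] of [C (t_ k)], by the Lipschitz bound
    on [C]. The inequality of [prox_regular_normalP], whose [r] is common to all times, then passes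
    to the limit. *)
Lemma proximal_normal_graph_closed (F : set_system nat) {FF : ProperFilter F}
    (t_ : nat -> R) (x_ z_ : nat -> 'rV[R]_n) t x z :
  (forall k, 0 <= t_ k) -> (forall k, proximal_normal (C (t_ k)) (x_ k) (z_ k)) ->
  t_ @ F --> t -> x_ @ F --> x -> z_ @ F --> z ->
  proximal_normal (C t) x z.
Proof.
move=> t_0 Nz tt xx zz.
have [t0 Ctx] := HC_graph_closed t_0 (fun k => (Nz k).1) tt xx.
have [r r0 prC] := HC_prox hC.
apply/(prox_regular_normalP x z r0 (prC _ t0)); split => // y Cy.
have /choice[y_ Hy] k : exists y', C (t_ k) y' /\ enorm (y - y') <= L_C * `|t - t_ k|.
  by have [y' ? ?] := HC_select t0 (t_0 k) Cy; exists y'.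
have yy : y_ @ F --> y.
  apply/cvg_enormP => e e0.
  have e1 : 0 < e / (L_C + 1) by rewrite !divr_gt0// ltr_wpDl// HC_constant_ge0.
  move/cvgrPdist_lt : tt => /(_ _ e1); apply: filterS => k tk.
  rewrite (le_lt_trans (Hy k).2)// (@le_lt_trans _ _ ((L_C + 1) * `|t - t_ k|))//.
    by rewrite ler_wpM2r// lerDl.
  by rewrite mulrC -ltr_pdivlMr// ltr_wpDl// HC_constant_ge0.
have yx : (fun k => y_ k - x_ k) @ F --> y - x by exact: cvgB.
have c1 : dot (z_ k) (y_ k - x_ k) @[k --> F] --> dot z (y - x).
  exact: cvg_dot.
have c2 : (2 * r)^-1 * enorm (z_ k) * enorm (y_ k - x_ k) ^+ 2 @[k --> F] -->
    (2 * r)^-1 * enorm z * enorm (y - x) ^+ 2.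
  apply: cvgM; first by apply: cvgM; [exact: cvg_cst|exact: cvg_enorm].
  by rewrite expr2; apply: cvgM; exact: cvg_enorm.
apply: (ler_cvg_to c1 c2); apply: nearW => k.
have /(prox_regular_normalP _ _ r0 (prC _ (t_0 k)))[_] := Nz k.
by apply; exact: (Hy k).1.
Qed.

Lemma proximal_normal_closed t x : 0 <= t -> C t x ->
  closed (proximal_normal (C t) x).
Proof.
move=> t0 Ctx; apply/closed_enormP => z H.
have /choice[z_ Hz] (k : nat) : exists z', proximal_normal (C t) x z' /\
    enorm (z - z') < k.+1%:R^-1.
  by have [|z' ? ?] := H k.+1%:R^-1; [rewrite invr_gt0|exists z'].
apply: (@proximal_normal_graph_closed \oo _ (fun=> t) (fun=> x) z_ t x z) => //.
- by move=> k; exact: (Hz k).1.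
- exact: cvg_cst.
- exact: cvg_cst.
- apply/cvg_enormP => e e0; near=> k.
  apply: (lt_trans (Hz k).2); near: k; exact: near_infty_natSinv_lt (PosNum e0).
Unshelve. all: by end_near. Qed.

Lemma eball_closed (B : R) : closed (@eball R n B).
Proof.
have := @preimage_closed _ _ (@enorm R n) [set r | r <= B] _ (@num_normedtype.closed_le _ _).
by apply => y _; exact: continuous_enorm.
Qed.

Lemma velocity_closed B t x : 0 <= t -> C t x -> closed (velocity C G B t x).
Proof.
move=> t0 Ctx; apply/closed_enormP => w H.
have /choice[zg Hzg] (k : nat) : exists zg : 'rV[R]_n * 'rV[R]_n,
    [/\ proximal_normal (C t) x zg.1, enorm zg.1 <= B, G t x zg.2 &
      enorm (w - (- zg.1 + zg.2)) < k.+1%:R^-1].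
  have [|_ [z [Nz zB] [g Gg <-]] ?] := H k.+1%:R^-1; first by rewrite invr_gt0.
  by exists (z, g).
have [U [UU ooU]] := ultraFilterLemma eventually_filter.
have [|z zz] := @ultra_bounded_cvg R n U (fun k => (zg k).1) B UU.
  by move=> k; have [] := Hzg k.
have ww : (fun k => - (zg k).1 + (zg k).2) @ U --> w.
  apply/cvg_enormP => e e0; apply: ooU; near=> k.
  have [_ _ _ wk] := Hzg k; apply: (lt_trans wk).
  near: k; exact: near_infty_natSinv_lt (PosNum e0).
(* The sums and the normals converge, hence so do the [G]-components. *)
have gg : (fun k => (zg k).2) @ U --> w + z.
  have -> : (fun k => (zg k).2) = (fun k => (- (zg k).1 + (zg k).2) + (zg k).1).
    by apply/funext => k; rewrite addrAC addNr add0r.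
  exact: cvgD.
exists z; first split.
- apply: (@closed_cvg _ _ U _ _ _ (proximal_normal_closed t0 Ctx) _ _ zz).
  by apply: nearW => k; have [] := Hzg k.
- apply: (@closed_cvg _ _ U _ _ _ (@eball_closed B) _ _ zz).
  by apply: nearW => k; have [] := Hzg k.
exists (w + z); last by rewrite addrCA addNr addr0.
apply: (@closed_cvg _ _ U _ _ _ (HG_closed hG t0) _ _ gg).
by apply: nearW => k; have [] := Hzg k.
Unshelve. all: by end_near. Qed.

Lemma velocity_nonempty B t x : 0 <= B -> 0 <= t -> C t x ->
  velocity C G B t x !=set0.
Proof.
move=> B0 t0 Ctx; have [g Gg] := HG_nonempty hG x t0.
exists (- 0 + g); exists 0; last by exists g.
by split; [exact: proximal_normal0|rewrite /eball/= enorm0].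
Qed.

Lemma velocity_bounded B t x w : 0 <= t -> velocity C G B t x w ->
  enorm w <= B + M.
Proof.
move=> t0 [z [_ zB] [g Gg <-]]; rewrite (le_trans (ler_enormD _ _))//.
by rewrite enormN lerD// (HG_bounded hG t0 Gg).
Qed.

Lemma velocity_convex B t x w1 w2 (l : R) : 0 <= t -> 0 <= l <= 1 ->
  velocity C G B t x w1 -> velocity C G B t x w2 ->
  velocity C G B t x ((1 - l) *: w1 + l *: w2).
Proof.
move=> t0 /andP[l0 l1] [z1 [N1 B1] [g1 G1 <-]] [z2 [N2 B2] [g2 G2 <-]].
have l1' : 0 <= 1 - l by rewrite subr_ge0.
exists ((1 - l) *: z1 + l *: z2).
  split; first exact: proximal_normal_conic.
  rewrite /eball/= (le_trans (ler_enormD _ _))// !enormZ !ger0_norm//.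
  rewrite (@le_trans _ _ ((1 - l) * B + l * B))//.
    by rewrite lerD// ler_wpM2l.
  by rewrite -mulrDl subrK mul1r.
exists ((1 - l) *: g1 + l *: g2); last by rewrite opprD !scalerDr !scalerN addrACA.
have cG := HG_convex hG (x := x) t0.
have l01 : Itv.spec (@Itv.num_sem R) (Itv.Real `[0%Z, 1%Z]) l.
  by apply/and3P; split; rewrite ?bnd_simp ?num_real.
have := cG g2 g1 (Itv.mk l01) (mem_set G2) (mem_set G1).
by rewrite inE /conv/= addrC.
Qed.

(** Upper semicontinuity of the support function in direction [q]. If it failed at all radii, the
    bounded components of the offending velocities would converge along an ultrafilter to a normal
    and an element of [G t x], giving a velocity at [(t, x)] that contradicts the gap [e]. *)
Lemma velocity_usc B t x (q : 'rV[R]_n) (e : R) :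
  0 <= t -> C t x -> 0 < e ->
  exists2 rho, 0 < rho & forall s y w, 0 <= s -> C s y ->
    `|t - s| < rho -> enorm (x - y) < rho -> velocity C G B s y w ->
    exists2 w', velocity C G B t x w' & dot w q <= dot w' q + e.
Proof.
move=> t0 Ctx e0; apply: contrapT => nH.
have /choice[a Ha] (k : nat) : exists a : R * 'rV[R]_n * 'rV[R]_n * 'rV[R]_n,
   let: (s, y, z, g) := a in
   [/\ 0 <= s /\ proximal_normal (C s) y z, enorm z <= B, G s y g,
       `|t - s| < k.+1%:R^-1 /\ enorm (x - y) < k.+1%:R^-1 &
       forall w', velocity C G B t x w' -> dot w' q + e < dot (- z + g) q].
  apply: contrapT => nk; apply: nH; exists (k.+1%:R^-1) => // s y w s0 Cy ts xy.
  move=> [z [Nz zB] [g Gg <-]]; apply: contrapT => nw; apply: nk.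
  exists (s, y, z, g); split => // w' Vw'; rewrite ltNge; apply/negP => le_w'.
  by apply: nw; exists w'.
pose s_ k := (a k).1.1.1; pose y_ k := (a k).1.1.2.
pose z_ k := (a k).1.2; pose g_ k := (a k).2.
have {}Ha k : [/\ 0 <= s_ k /\ proximal_normal (C (s_ k)) (y_ k) (z_ k),
    enorm (z_ k) <= B, G (s_ k) (y_ k) (g_ k),
    `|t - s_ k| < k.+1%:R^-1 /\ enorm (x - y_ k) < k.+1%:R^-1 &
    forall w', velocity C G B t x w' -> dot w' q + e < dot (- z_ k + g_ k) q].
  by have := Ha k; rewrite /s_ /y_ /z_ /g_; case: (a k) => [[[]]].
have [U [UU ooU]] := ultraFilterLemma eventually_filter.
have ss : s_ @ U --> t.
  apply/cvgrPdist_lt => d d0; apply: ooU; near=> k.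
  have [_ _ _ [tk _] _] := Ha k; apply: (lt_trans tk).
  near: k; exact: near_infty_natSinv_lt (PosNum d0).
have yy : y_ @ U --> x.
  apply/cvg_enormP => d d0; apply: ooU; near=> k.
  have [_ _ _ [_ tk] _] := Ha k; apply: (lt_trans tk).
  near: k; exact: near_infty_natSinv_lt (PosNum d0).
have [|z zz] := @ultra_bounded_cvg R n U z_ B UU.
  by move=> k; have [] := Ha k.
have [|g gg] := @ultra_bounded_cvg R n U g_ M UU.
  by move=> k; have [[s0 _] _ /(HG_bounded hG s0)] := Ha k.
have Nz : proximal_normal (C t) x z.
  apply: (proximal_normal_graph_closed (F := U) _ _ ss yy zz).
  - by move=> k; have [[]] := Ha k.
  - by move=> k; have [[]] := Ha k.
have zB : enorm z <= B.
  apply: (@closed_cvg _ _ U _ _ _ (@eball_closed B) _ _ zz).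
  by apply: nearW => k; have [] := Ha k.
(* The elements [g_ k] are moved into [G t x] by the Lipschitz bound; [L_G] has no prescribed sign,
   hence its absolute value in the constants. *)
have Gg : G t x g.
  apply/(closed_enormP _).1; first exact: (HG_closed hG).
  move=> d d0.
  have d1 : 0 < d / 2 by rewrite divr_gt0.
  have d2 : 0 < d / 2 / 2 / (`|L_G| + 1) by rewrite !divr_gt0// ltr_wpDl.
  have H1 : \forall k \near U, `|t - s_ k| < d / 2 / 2 / (`|L_G| + 1).
    by move/cvgrPdist_lt : ss; exact.
  have H2 : \forall k \near U, enorm (x - y_ k) < d / 2 / 2 / (`|L_G| + 1).
    by move/cvg_enormP : yy; exact.
  have H3 : \forall k \near U, enorm (g - g_ k) < d / 2.
    by move/cvg_enormP : gg; exact.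
  have [k [[tk xk] gk]] := filter_ex (filterI (filterI H1 H2) H3).
  have [[s0 _] _ Gk _ _] := Ha k.
  have [w Gw wk] := HG_select x s0 t0 Gk.
  exists w => //; rewrite (le_lt_trans (ler_enorm_dist (g_ k) _ _))//.
  rewrite [ltRHS]splitr ltr_leD//; apply: (le_trans wk).
  have txk : enorm (tx (s_ k) (y_ k) - tx t x) <= d / 2 / (`|L_G| + 1).
    rewrite txB (le_trans (enorm_tx_le _ _))// distrC enorm_distC.
    have -> : d / 2 / (`|L_G| + 1) =
        d / 2 / 2 / (`|L_G| + 1) + d / 2 / 2 / (`|L_G| + 1).
      by rewrite -mulrDl -splitr.
    by rewrite lerD// ltW.
  apply: (@le_trans _ _ ((`|L_G| + 1) * (d / 2 / (`|L_G| + 1)))); last first.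
    by rewrite mulrC divfK// gt_eqF// ltr_wpDl.
  apply: (@le_trans _ _ ((`|L_G| + 1) * enorm (tx (s_ k) (y_ k) - tx t x))).
    by rewrite ler_wpM2r ?enorm_ge0// (le_trans (ler_norm _))// lerDl.
  by rewrite ler_wpM2l// addr_ge0.
have Vzg : velocity C G B t x (- z + g) by exists z => //; exists g.
have zgq : dot (- z_ k + g_ k) q @[k --> U] --> dot (- z + g) q.
  apply: cvg_dot; last exact: cvg_cst.
  by apply: cvgD => //; exact: cvgN.
have : \forall k \near U, `|dot (- z + g) q - dot (- z_ k + g_ k) q| < e.
  by move/cvgrPdist_lt : zgq; exact.
move=> /filter_ex[k]; have [_ _ _ _ /(_ _ Vzg)] := Ha k.
by rewrite distrC => /[swap] /ltr_normlW; lra.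
Unshelve. all: by end_near. Qed.

Lemma graph_cylinderP (K : set 'rV[R]_n) t x :
  (graph C `&` time_cylinder K) (tx t x) <-> [/\ 0 <= t, C t x & K x].
Proof.
split=> [[[s [y [s0 Cy /tx_inj[ts xy]]]] [s' [y' [_ Ky /tx_inj[_ xy']]]]]|[t0 Cx Kx]].
  by rewrite ts; split => //; [rewrite xy|rewrite xy'].
by split; exists t, x.
Qed.

Lemma graph_cylinder_closed (K : set 'rV[R]_n) : closed K ->
  closed (graph C `&` time_cylinder K).
Proof.
move=> cK; apply/closed_enormP => p.
have [t [x ->{p}]] := tx_surj p; move=> H.
have /choice[a Ha] (k : nat) : exists a : R * 'rV[R]_n,
    [/\ 0 <= a.1, C a.1 a.2, K a.2 & enorm (tx t x - tx a.1 a.2) < k.+1%:R^-1].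
  have [|p' + H'] := H k.+1%:R^-1; first by rewrite invr_gt0.
  have [s [y p'E]] := tx_surj p'; rewrite p'E in H' *.
  by move=> /graph_cylinderP[? ? ?]; exists (s, y).
have aa1 : (fun k => (a k).1) @ \oo --> t.
  apply/cvgrPdist_lt => e e0; near=> k; have [_ _ _] := Ha k.
  rewrite txB => /(le_lt_trans (normr_le_enorm_tx _ _)) /lt_trans; apply.
  near: k; exact: near_infty_natSinv_lt (PosNum e0).
have aa2 : (fun k => (a k).2) @ \oo --> x.
  apply/cvg_enormP => e e0; near=> k; have [_ _ _] := Ha k.
  rewrite txB => /(le_lt_trans (enorm_le_enorm_tx _ _)) /lt_trans; apply.
  near: k; exact: near_infty_natSinv_lt (PosNum e0).
have [||t0 Cx] := HC_graph_closed _ _ aa1 aa2.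
- by move=> k; have [] := Ha k.
- by move=> k; have [] := Ha k.
apply/graph_cylinderP; split => //.
apply: (@closed_cvg _ _ _ _ _ _ cK _ _ aa2).
by apply: nearW => k; have [] := Ha k.
Unshelve. all: by end_near. Qed.

End MovingSet.

(** * Necessity *)

Section VectorDerivative.
Context {R : realType} {n : nat}.
Implicit Types (x : R -> 'rV[R]_n) (q : 'rV[R]_n).

Lemma derive1_cvg (V : normedModType R) (x : R -> V) (t : R) : derivable x t 1 ->
  h^-1 *: (x (h + t) - x t) @[h --> 0^'] --> derive1 x t.
Proof.
move=> xt; rewrite derive1E.
have -> : (fun h => h^-1 *: (x (h + t) - x t)) =
    (fun h => h^-1 *: (x (h *: 1 + t) - x t)).
  by apply/funext => h; rewrite [h *: 1]mulr1.
exact: xt.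
Qed.

Lemma derive1_of_cvg (f : R -> R) (t l : R) :
  h^-1 * (f (h + t) - f t) @[h --> 0^'] --> l -> derivable f t 1 /\ derive1 f t = l.
Proof.
move=> H; split; last by apply: cvg_lim.
apply/cvg_ex; exists l.
have -> : (fun h => h^-1 *: (f (h *: 1 + t) - f t)) =
    (fun h => h^-1 * (f (h + t) - f t)).
  by apply/funext => h; rewrite [h *: 1]mulr1.
exact: H.
Qed.

Lemma derivable_dot_tx (tau : R -> R) x (p0 : R) q t :
  derivable tau t 1 -> derivable x t 1 ->
  derivable (fun s => dot (tx (tau s) (x s)) (tx p0 q)) t 1 /\
  derive1 (fun s => dot (tx (tau s) (x s)) (tx p0 q)) t =
    derive1 tau t * p0 + dot (derive1 x t) q.
Proof.
move=> /derive1_cvg dtau /derive1_cvg dx; apply: derive1_of_cvg.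
have -> : (fun h => h^-1 * (dot (tx (tau (h + t)) (x (h + t))) (tx p0 q) -
      dot (tx (tau t) (x t)) (tx p0 q))) =
    (fun h => h^-1 * (tau (h + t) - tau t) * p0 +
      dot (h^-1 *: (x (h + t) - x t)) q).
  by apply/funext => h; rewrite !dot_tx dotZl dotBl; ring.
apply: cvgD; first by apply: cvgM; [exact: dtau|exact: cvg_cst].
by apply: cvg_dot => //; exact: cvg_cst.
Qed.

Lemma derivable_enorm_expansion x t (e : R) : derivable x t 1 -> 0 < e ->
  exists2 d, 0 < d & forall y, `|y - t| < d ->
    enorm (x y - x t - (y - t) *: derive1 x t) <= e * `|y - t|.
Proof.
move=> /derive1_cvg /cvg_enormP xt e0.
have [d /= d0 H] := xt _ e0; exists d => // y yd.
have [->|ys] := eqVneq y t.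
  by rewrite !subrr scale0r subr0 normr0 mulr0 enorm0.
have ys0 : y - t != 0 by rewrite subr_eq0.
have := H (y - t); rewrite /= sub0r normrN => /(_ yd ys0); rewrite subrK => H1.
rewrite (_ : x y - x t - _ = - ((y - t) *:
   (derive1 x t - (y - t)^-1 *: (x y - x t)))); last first.
  by rewrite scalerBr scalerA divff// scale1r opprB.
by rewrite enormN enormZ mulrC ler_wpM2r// ltW.
Qed.

End VectorDerivative.

Section Necessity.
Context {R : realType} {n : nat}.
Variables (C : R -> set 'rV[R]_n) (G : R -> 'rV[R]_n -> set 'rV[R]_n).
Variables (L_C M L_G : R).
Hypotheses (hC : HC C L_C) (hG : HG G M L_G).
Local Notation mu := (@lebesgue_measure R).

(* Going back from [x t] to [x (t - h)] and then to the nearest point of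
   [C (t0 + t)] is an almost admissible test direction for [zeta]. *)
Lemma normal_component_le (t0 t T : R) (x : R -> 'rV[R]_n) zeta g :
  0 <= t0 -> 0 < t <= T -> (forall s, 0 <= s <= T -> C (t0 + s) (x s)) ->
  derivable x t 1 -> derive1 x t = - zeta + g ->
  proximal_normal (C (t0 + t)) (x t) zeta -> enorm g <= M ->
  enorm zeta <= L_C + M.
Proof.
move=> t00 /andP[t_gt0 tT] Cx dx xE [_ [sigma [sigma0 Nz]]] gM.
have L0 := HC_constant_ge0 hC; have M0 := HG_bound_ge0 hG.
set w := derive1 x t in xE.
(* [K * h] will bound the distance from [x t] to the test point: [L_C] for the jump onto
   [C (t0 + t)], [enorm w + 1] for the backward motion. *)
pose K := L_C + enorm w + 1.
have K0 : 0 <= K by rewrite !addr_ge0// enorm_ge0.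
suff H e : 0 < e -> e <= 1 ->
    enorm zeta ^+ 2 <= enorm zeta * (L_C + M) + e * (enorm zeta + 1).
  have H2 : enorm zeta ^+ 2 <= enorm zeta * (L_C + M).
    apply/ler_addgt0Pr => e e0.
    pose e' := Num.min 1 (e / (enorm zeta + 1)).
    have z1 : 0 < enorm zeta + 1 by rewrite ltr_wpDl// enorm_ge0.
    have e'0 : 0 < e' by rewrite lt_min ltr01 divr_gt0.
    have e'1 : e' <= 1 by rewrite ge_min lexx.
    apply: (le_trans (H _ e'0 e'1)); rewrite lerD2l.
    by rewrite -ler_pdivlMr// ge_min lexx orbT.
  have [z0|z0] := eqVneq (enorm zeta) 0; first by rewrite z0 addr_ge0.
  have zp : 0 < enorm zeta by rewrite lt_neqAle eq_sym z0 enorm_ge0.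
  by rewrite -(ler_pM2l zp) -expr2.
move=> e0 e1.
have [d d0 Hd] := derivable_enorm_expansion dx e0.
(* The three bounds make the expansion at [t] valid, keep [t - h] nonnegative, and bring the
   quadratic term below [e * h]. *)
pose h := Num.min (d / 2) (Num.min t (e / (sigma * K ^+ 2 + 1))).
have sK : 0 < sigma * K ^+ 2 + 1 by rewrite ltr_wpDl// mulr_ge0// sqr_ge0.
have h0 : 0 < h by rewrite !lt_min !divr_gt0// t_gt0.
have ht : h <= t by rewrite !ge_min lexx orbT.
have hd : h < d.
  by rewrite gt_min; apply/orP; left; rewrite ltr_pdivrMr// ltr_pMr// ltrDl.
have hs : sigma * K ^+ 2 * h <= e.
  rewrite (@le_trans _ _ ((sigma * K ^+ 2 + 1) * h))//.
    by rewrite ler_wpM2r ?(ltW h0)// lerDl.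
  by rewrite mulrC -ler_pdivlMr// !ge_min lexx !orbT.
have := Hd (t - h); rewrite addrAC subrr sub0r normrN gtr0_norm// => /(_ hd).
set r := _ - _ => rh.
have xh : x (t - h) - x t = r - h *: w.
  by rewrite /r scaleNr opprK addrK.
have th0 : 0 <= t0 + (t - h) by rewrite addr_ge0// subr_ge0.
have tt0 : 0 <= t0 + t by rewrite addr_ge0// ltW.
have [|y Cy] := HC_select hC th0 tt0 (Cx (t - h) _).
  by rewrite subr_ge0 ht/= (le_trans _ tT)// lerBlDr lerDl ltW.
rewrite (_ : t0 + (t - h) - (t0 + t) = - h); last by ring.
rewrite normrN gtr0_norm// => xy.
have xh_le : enorm (x (t - h) - x t) <= (enorm w + 1) * h.
  rewrite xh (le_trans (ler_enormB _ _))// enormZ gtr0_norm// mulrDl addrC mulrC mul1r.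
  by rewrite mulrC lerD2l (le_trans rh)// ler_piMl// ltW.
have yx_le : enorm (y - x t) <= K * h.
  rewrite (le_trans (ler_enorm_dist (x (t - h)) _ _))// enorm_distC.
  have -> : K * h = L_C * h + (enorm w + 1) * h by rewrite /K; ring.
  exact: lerD.
have := Nz _ Cy.
have : sigma * enorm (y - x t) ^+ 2 <= e * h.
  rewrite (@le_trans _ _ (sigma * (K * h) ^+ 2))//.
    by rewrite ler_wpM2l// lerXn2r ?nnegrE ?enorm_ge0// mulr_ge0// ltW.
  by rewrite exprMn mulrA [X in _ * X]expr2 mulrA ler_wpM2r// ltW.
(* The first difference is [r - h *: w] with [w = - zeta + g], so pairing with [zeta] produces
   [h * enorm zeta ^+ 2], the quantity to bound. *)
have -> : y - x t = (x (t - h) - x t) - (x (t - h) - y).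
  by rewrite opprB [RHS]addrC addrA subrK.
rewrite dotBr [X in dot zeta X - _]xh [dot zeta (r - _)]dotBr dotZr xE
  [dot zeta (- zeta + g)]dotDr [dot zeta (- zeta)]dotNr -enorm_sqr.
have A1 : dot zeta (x (t - h) - y) <= enorm zeta * (L_C * h).
  by rewrite (le_trans (dot_le_enorm _ _))// ler_wpM2l// enorm_ge0.
have A2 : - dot zeta r <= enorm zeta * (e * h).
  by rewrite -dotNl (le_trans (dot_le_enorm _ _))// enormN ler_wpM2l// enorm_ge0.
have A3 : dot zeta g <= enorm zeta * M.
  by rewrite (le_trans (dot_le_enorm _ _))// ler_wpM2l// enorm_ge0.
move: (dot zeta (x (t - h) - y)) A1 (dot zeta r) A2 (dot zeta g) A3 => a A1 b A2 c A3.
set S := sigma * _.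
move=> B1 B2.
rewrite -(ler_pM2r h0).
have : c * h <= enorm zeta * M * h by rewrite ler_wpM2r// ltW.
lra.
Qed.

Section Solution.
Variables (t0 T : R) (x0 : 'rV[R]_n) (tau : R -> R) (x : R -> 'rV[R]_n).
Hypotheses (t0_ge0 : 0 <= t0) (sol : is_solution C G t0 x0 T tau x).

(** The scalar product of the solution with a fixed vector inherits absolute continuity, so
    [ac_derive_ge] integrates the bound on its derivative. *)
Lemma solution_growth (p0 : R) (p : 'rV[R]_n) (c h0 : R) : h0 <= T ->
  {ae mu, forall t, 0 <= t <= h0 ->
    [/\ derivable tau t 1, derive1 tau t = 1, derivable x t 1 &
        c <= p0 + dot (derive1 x t) p]} ->
  forall h, 0 <= h <= h0 ->
    c * h <= p0 * (tau h - t0) + dot (x h - x0) p.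
Proof.
move=> h0T dc h hh0.
have [ac [tau0 x_0] _ _] := sol.
pose f s := dot (tx (tau s) (x s)) (tx p0 p).
have fE s : f s = tau s * p0 + dot (x s) p by rewrite /f dot_tx.
have acf : scalar_ac h0 f.
  move=> e e0.
  pose q := enorm (tx p0 p) + 1.
  have q0 : 0 < q by rewrite ltr_wpDl// enorm_ge0.
  have [d d0 H] := ac (e / q) (divr_gt0 e0 q0).
  exists d => // k u v uv triv lend.
  have uvT i : 0 <= u i /\ u i <= v i /\ v i <= T.
    by have [? [? vi]] := uv i; split => //; split => //; exact: le_trans h0T.
  have := H k u v uvT triv lend; rewrite ltr_pdivlMr//; apply: le_lt_trans.
  rewrite mulr_suml ler_sum// => i _; rewrite /f -dotBl.
  rewrite (le_trans (normr_dot_le _ _))// ler_wpM2l ?enorm_ge0//.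
  by rewrite /q lerDl.
have : {ae mu, forall t, 0 <= t <= h0 -> derivable f t 1 /\ c <= derive1 f t}.
  move: dc; apply: filterS; first exact: (ae_filter_ringOfSetsType mu).
  move=> t H /H[dtau tau1 dx cp].
  have [df dfE] := derivable_dot_tx p0 p dtau dx.
  by split; rewrite // dfE tau1 mul1r.
move=> /(ac_derive_ge acf) /(_ h hh0); rewrite !fE tau0 x_0 dotBl.
by rewrite mulrBr (mulrC p0) (mulrC p0); lra.
Qed.

(** [solution_growth] in the time directions 1 and -1 yields the two inequalities. *)
Lemma solution_time h : 0 <= h <= T -> tau h = t0 + h.
Proof.
move=> hT; have [_ _ _ aesol] := sol.
have H c : {ae mu, forall t, 0 <= t <= T ->
    [/\ derivable tau t 1, derive1 tau t = 1, derivable x t 1 &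
        c <= c + dot (derive1 x t) 0]}.
  move: aesol; apply: filterS; first exact: (ae_filter_ringOfSetsType mu).
  by move=> t Ht /Ht[? ? ? _]; split => //; rewrite dot0r addr0.
have := solution_growth (lexx T) (H 1) hT.
have := solution_growth (lexx T) (H (-1)) hT.
rewrite dot0r; lra.
Qed.

Lemma solution_velocity : {ae mu, forall t, 0 <= t <= T ->
    [/\ derivable tau t 1, derive1 tau t = 1, derivable x t 1 &
        velocity C G (L_C + M) (t0 + t) (x t) (derive1 x t)]}.
Proof.
have [_ _ Cx aesol] := sol.
(* Time 0 is discarded because the bound on the normal component moves backwards in time. *)
have ae0 : {ae mu, forall t : R, t != 0}.
  exists [set 0]; split => //; first by rewrite lebesgue_measure_set1.
  by move=> t /= /negP; rewrite negbK => /eqP.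
move: aesol ae0; apply: filterS2; first exact: (ae_filter_ringOfSetsType mu).
move=> t Ht tn0 tT; have [dtau tau1 dx [z Nz [g Gg xE]]] := Ht tT.
have /andP[t_ge0 _] := tT.
rewrite solution_time// in Nz Gg.
split => //; exists z; last by exists g.
split => //; apply: (@normal_component_le t0 t T x z g) => //.
- by case/andP: tT => _ ->; rewrite lt_neqAle eq_sym tn0 t_ge0.
- by move=> s sT; rewrite -solution_time//; exact: Cx.
- exact: (HG_bounded hG (addr_ge0 t0_ge0 t_ge0) Gg).
Qed.

(** The increment [q] is tested against itself: the velocities have norm at most [m], so
    [enorm q ^+ 2 <= m * enorm q * h]. The signs are reversed because [solution_growth] gives lower
    bounds. *)
Lemma solution_lipschitz h : 0 <= h <= T ->
  enorm (tx h (x h - x0)) <= (1 + (L_C + M + M)) * h.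
Proof.
move=> hT; have /andP[h0 _] := hT.
set q := tx h (x h - x0); set m := 1 + _.
have H0 : {ae mu, forall t, 0 <= t <= T ->
    [/\ derivable tau t 1, derive1 tau t = 1, derivable x t 1 &
        - (m * enorm q) <= - h + dot (derive1 x t) (- (x h - x0))]}.
  move: solution_velocity; apply: filterS; first exact: (ae_filter_ringOfSetsType mu).
  move=> t Ht tT; have [? ? ? Vx] := Ht tT; split => //.
  have /andP[t_ge0 _] := tT.
  rewrite dotNr -opprD lerN2 -[X in X + _]mul1r -dot_tx -/q dotC dotC.
  rewrite (le_trans (dot_le_enorm _ _))// ler_wpM2r ?enorm_ge0//.
  rewrite (le_trans (enorm_tx_le _ _))// normr1 lerD2l.
  exact: (velocity_bounded hG (addr_ge0 t0_ge0 t_ge0) Vx).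
have := solution_growth (lexx T) H0 hT.
rewrite (solution_time hT) [t0 + h]addrC addrK dotNr.
have -> : - h * h + - dot (x h - x0) (x h - x0) = - enorm q ^+ 2.
  by rewrite enorm_sqr dot_tx; ring.
have [q0 _|q0] := eqVneq (enorm q) 0.
  rewrite q0 mulr_ge0// /m !addr_ge0//; first exact: (HC_constant_ge0 hC).
    exact: (HG_bound_ge0 hG).
  exact: (HG_bound_ge0 hG).
have qp : 0 < enorm q by rewrite lt_neqAle eq_sym q0 enorm_ge0.
move=> H; rewrite -(ler_pM2l qp) -expr2 -lerN2.
by rewrite mulrA (mulrC (enorm q)) -mulNr.
Qed.

End Solution.

Lemma weak_invariance_necessary (K : set 'rV[R]_n) (t0 : R) (x0 : 'rV[R]_n)
    (p : 'rV[R]_(1 + n)) :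
  weakly_invariant C G (time_cylinder K) ->
  (graph C `&` time_cylinder K) (tx t0 x0) ->
  proximal_normal (graph C `&` time_cylinder K) (tx t0 x0) p ->
  sum_of_mins_le0
    [set tx 0 v | v in [set - zeta | zeta in proximal_normal (C t0) x0]
                       `&` eball (L_C + M)]
    [set tx 1 g | g in G t0 x0] p.
Proof.
move=> winv Sx0 [_ [sigma [sigma0 Np]]].
have [T [tau [x [T0 sol Kx]]]] := winv _ _ Sx0.
have [t0_ge0 Cx0 Kx0] := (graph_cylinderP _ _ _ _).1 Sx0.
have L0 := HC_constant_ge0 hC; have M0 := HG_bound_ge0 hG.
have [p0 [q pE]] := tx_surj p; rewrite {}pE in Np *.
(* Only the space component [q] of [p] matters for the minimisers; the time component contributes 0
   to the first minimum and [p0] to the second. *)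
have [||v [[z Nz vz] vB] vmin] :=
    @dot_min_attained _ _ ([set - zeta | zeta in proximal_normal (C t0) x0]
      `&` eball (L_C + M)) (L_C + M) q _ (fun v Av => Av.2).
- apply: closedI; last exact: eball_closed.
  rewrite (_ : [set _ | _ in _] = -%R @^-1` proximal_normal (C t0) x0); last first.
    apply/seteqP; split => [v [z Nz <-]|v Nv] /=; first by rewrite opprK.
    by exists (- v) => //; rewrite opprK.
  apply: preimage_closed; last exact: (proximal_normal_closed hC t0_ge0 Cx0).
  by move=> v _; exact: opp_continuous.
- exists 0; split; last by rewrite /eball/= enorm0 addr_ge0.
  by exists 0; [exact: proximal_normal0|rewrite oppr0].
have [g Gg gmin] := dot_min_attained q (HG_closed hG t0_ge0)
  (fun v => HG_bounded hG t0_ge0) (HG_nonempty hG x0 t0_ge0).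
exists (dot v q), (p0 + dot g q); split.
- split; first by exists (tx 0 v); [exists v => //; split => //; exists z|
    rewrite dot_tx mul0r add0r].
  by move=> _ [_ [u Au <-] <-]; rewrite dot_tx mul0r add0r; exact: vmin.
- split; first by exists (tx 1 g); [exists g|rewrite dot_tx mul1r].
  by move=> _ [_ [u Au <-] <-]; rewrite dot_tx mul1r lerD2l; exact: gmin.
rewrite leNgt; apply/negP => pos.
(* Half of the supposedly positive sum is given up to semicontinuity; the other half remains as
   growth rate. The direction [- q] turns the upper bound of [velocity_usc] into a lower one. *)
pose e := (dot v q + (p0 + dot g q)) / 2.
have e0 : 0 < e by rewrite divr_gt0.
have [rho rho0 usc] := velocity_usc hC hG (L_C + M) (- q) t0_ge0 Cx0 e0.
pose m := 1 + (L_C + M + M).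
have m1 : 1 <= m by rewrite lerDl !addr_ge0.
have m0 : 0 < m by exact: lt_le_trans m1.
(* Up to [h0] the solution stays within [rho] of its start, and strictly before [T], where it is
   known to lie in the cylinder. *)
pose h0 := Num.min (T / 2) (rho / (2 * m)).
have h00 : 0 < h0 by rewrite lt_min !divr_gt0// mulr_gt0.
have h0T : h0 < T.
  by rewrite gt_min; apply/orP; left; rewrite ltr_pdivrMr// ltr_pMr// ltrDl.
have h0rho : m * h0 < rho.
  apply: (@le_lt_trans _ _ (rho / 2)); last by rewrite ltr_pdivrMr// ltr_pMr// ltrDl.
  rewrite mulrC -ler_pdivlMr// -mulrA -invfM.
  by rewrite ge_min lexx orbT.
have aeh : {ae mu, forall t, 0 <= t <= h0 ->
    [/\ derivable tau t 1, derive1 tau t = 1, derivable x t 1 &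
        e <= p0 + dot (derive1 x t) q]}.
  move: (solution_velocity t0_ge0 sol); apply: filterS.
    exact: (ae_filter_ringOfSetsType mu).
  move=> t Ht /andP[t_ge0 th0].
  have tT : 0 <= t <= T by rewrite t_ge0 (le_trans th0)// ltW.
  have [? ? ? Vx] := Ht tT; split => //.
  have [_ _ Cx _] := sol.
  have mt : m * t < rho by rewrite (le_lt_trans _ h0rho)// ler_pM2l.
  have tn : `|t| < rho by rewrite ger0_norm// (le_lt_trans _ mt)// ler_peMl.
  have t0t : `|t0 - (t0 + t)| < rho by rewrite opprD addrA subrr sub0r normrN.
  have xxt : enorm (x0 - x t) < rho.
    rewrite enorm_distC (le_lt_trans _ mt)//.
    exact: le_trans (enorm_le_enorm_tx t _) (solution_lipschitz t0_ge0 sol tT).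
  have Cxt : C (t0 + t) (x t) by rewrite -(solution_time sol tT); exact: Cx.
  have [_ [z' [Nz' z'B] [g' Gg' <-]]] :=
    usc _ _ _ (addr_ge0 t0_ge0 t_ge0) Cxt t0t xxt Vx.
  have := gmin _ Gg'.
  have : dot v q <= dot (- z') q.
    by apply: vmin; split; [exists z'|rewrite /eball/= enormN].
  rewrite !dotNr dotDl /e; lra.
(* For this [h] one has [sigma * m ^+ 2 * h < e], which contradicts
   [e * h <= sigma * (m * h) ^+ 2]. *)
pose h := Num.min h0 (e / (2 * (sigma * m ^+ 2 + 1))).
have s1 : 0 < sigma * m ^+ 2 + 1 by rewrite ltr_wpDl// mulr_ge0// sqr_ge0.
have h_gt0 : 0 < h by rewrite lt_min h00 divr_gt0// mulr_gt0.
have hh0 : 0 <= h <= h0 by rewrite (ltW h_gt0) ge_min lexx.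
have hT : 0 <= h <= T.
  by rewrite (ltW h_gt0) (@le_trans _ _ h0) ?(ltW h0T)// ge_min lexx.
have hT' : 0 <= h < T by rewrite (ltW h_gt0) (@le_lt_trans _ _ h0)// ge_min lexx.
have := solution_growth sol (ltW h0T) aeh hh0.
have lip := solution_lipschitz t0_ge0 sol hT.
have Sh : (graph C `&` time_cylinder K) (tx (tau h) (x h)).
  split; last exact: Kx.
  have [_ _ Cx _] := sol; exists (tau h), (x h); split => //; last exact: Cx.
  by rewrite (solution_time sol hT) addr_ge0// ltW.
have := Np _ Sh; rewrite txB (solution_time sol hT) [t0 + h]addrC addrK dot_tx.
rewrite (dotC q) => H1 H2; have {H1 H2} := le_trans H2 H1.
have : sigma * enorm (tx h (x h - x0)) ^+ 2 <= sigma * (m * h) ^+ 2.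
  by rewrite ler_wpM2l// lerXn2r ?nnegrE ?enorm_ge0// mulr_ge0// ltW.
move=> H1 H2; have {H1 H2} := le_trans H2 H1.
rewrite exprMn mulrA [h ^+ 2]expr2 mulrA ler_pM2r//; apply/negP; rewrite -ltNge.
apply: (@le_lt_trans _ _ ((sigma * m ^+ 2 + 1) * h)).
  by rewrite ler_pM2r// lerDl.
apply: (@le_lt_trans _ _ (e / 2)); last by rewrite ltr_pdivrMr// ltr_pMr// ltrDl.
rewrite mulrC -ler_pdivlMr// -mulrA -invfM.
by rewrite ge_min lexx orbT.
Qed.

End Necessity.

(** * Euler polygons by proximal aiming *)

Section EulerLimit.
Context {R : realType} {N : nat}.
Variables (S : set 'rV[R]_N) (proj vel : 'rV[R]_N -> 'rV[R]_N) (m : R) (z0 : 'rV[R]_N).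
Hypotheses (cS : closed S) (Sz0 : S z0) (m_gt0 : 0 < m).
Hypothesis Sproj : forall z, S (proj z).
Hypothesis proj_min : forall z y, S y -> enorm (z - proj z) <= enorm (z - y).
Hypothesis vel_le : forall z, enorm (vel z) <= m.
Hypothesis vel_aim : forall z, dot (vel z) (z - proj z) <= 0.

Let step (k : nat) : R := k.+1%:R^-1.
Let Z (k i : nat) : 'rV[R]_N := iter i (fun z => z + step k *: vel z) z0.
Let idx (k : nat) (t : R) : nat := Num.truncn (t * k.+1%:R).

Let step_gt0 k : 0 < step k.
Proof. by rewrite invr_gt0. Qed.

Let step_cvg (e : R) : 0 < e -> \forall k \near \oo, step k < e.
Proof. by move=> e0; exact: (near_infty_natSinv_lt (PosNum e0)). Qed.

Let idx_le k t : 0 <= t -> (idx k t)%:R * step k <= t.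
Proof.
move=> t0; rewrite ler_pdivrMr//.
by have := truncn_itv (mulr_ge0 t0 (ler0n R k.+1)) => /andP[].
Qed.

Let idx_ge k t : 0 <= t -> t - step k <= (idx k t)%:R * step k.
Proof.
move=> t0; rewrite lerBlDr -[X in _ + X]mul1r -mulrDl natr1 ler_pdivlMr//.
by have := truncn_itv (mulr_ge0 t0 (ler0n R k.+1)) => /andP[_ /ltW].
Qed.

Let idx_mono k s t : s <= t -> (idx k s <= idx k t)%N.
Proof. by move=> st; apply: le_truncn; rewrite ler_wpM2r. Qed.

Let Z_growth k i j q c : (i <= j)%N ->
  (forall l, (i <= l < j)%N -> dot (vel (Z k l)) q <= c) ->
  dot (Z k j - Z k i) q <= (j%:R - i%:R) * step k * c.
Proof.
move=> ij; rewrite -(subnKC ij); elim: (j - i)%N => [|d IH] H.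
  by rewrite addn0 !subrr dot0l mul0r mul0r.
rewrite addnS /Z iterS -/(Z k (i + d)) -/(Z k i) addrAC dotDl dotZl.
have -> : ((i + d).+1%:R - i%:R) * step k * c =
    ((i + d)%:R - i%:R) * step k * c + step k * c.
  by rewrite -natr1; ring.
apply: lerD.
  by apply: IH => l /andP[il ld]; apply: H; rewrite il addnS ltnS ltnW.
by rewrite ler_pM2l//; apply: H; rewrite leq_addr addnS ltnSn.
Qed.

Let Z_lipschitz k i j : (i <= j)%N ->
  enorm (Z k j - Z k i) <= (j%:R - i%:R) * step k * m.
Proof.
move=> ij; set q := Z k j - Z k i.
have Hq l : (i <= l < j)%N -> dot (vel (Z k l)) q <= m * enorm q.
  by move=> _; rewrite (le_trans (dot_le_enorm _ _))// ler_wpM2r// enorm_ge0.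
have := Z_growth ij Hq.
rewrite -/q -enorm_sqr => H.
have [q0|q0] := eqVneq (enorm q) 0.
  by rewrite q0 !mulr_ge0 ?subr_ge0 ?ler_nat// ltW.
have qp : 0 < enorm q by rewrite lt_neqAle eq_sym q0 enorm_ge0.
by rewrite -(ler_pM2r qp) -expr2 -[leRHS]mulrA.
Qed.

(* Proximal aiming: the velocity does not point away from the projection, so
   the squared distance to [S] only picks up the second-order term. *)
Let Z_dist k i :
  enorm (Z k i - proj (Z k i)) ^+ 2 <= i%:R * (step k * m) ^+ 2.
Proof.
elim: i => [|i IH].
  have := proj_min z0 Sz0; rewrite subrr enorm0 mul0r => d0.
  have -> : enorm (Z k 0 - proj (Z k 0)) = 0.
    by apply/eqP; rewrite eq_le enorm_ge0 andbT.
  by rewrite expr0n.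
have : enorm (Z k i.+1 - proj (Z k i.+1)) ^+ 2 <= enorm (Z k i.+1 - proj (Z k i)) ^+ 2.
  by rewrite lerXn2r ?nnegrE ?enorm_ge0// proj_min.
move=> /le_trans; apply.
rewrite /Z iterS -/(Z k i) addrAC enorm_sqrD dotZl enormZ (gtr0_norm (step_gt0 k)).
set d := Z k i - _ in IH *; set v := vel _.
have va : step k * dot v d <= 0 by rewrite pmulr_rle0// vel_aim.
have vv : (step k * enorm v) ^+ 2 <= (step k * m) ^+ 2.
  rewrite !exprMn ler_pM2l ?exprn_gt0//.
  by rewrite lerXn2r ?nnegrE ?enorm_ge0 ?(ltW m_gt0) ?vel_le.
rewrite -natr1 mulrDl mul1r; lra.
Qed.

(** Up to time [t] there are at most [t / step k] steps, each adding [(step k * m) ^+ 2], so the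
    squared distance is at most [t * m ^+ 2 * step k]. *)
Let Z_dist_cvg t e : 0 <= t -> 0 < e -> \forall k \near \oo,
  forall l, (l <= idx k t)%N -> enorm (Z k l - proj (Z k l)) < e.
Proof.
move=> t0 e0.
have e1 : 0 < e ^+ 2 / (t * m ^+ 2 + 1).
  by rewrite divr_gt0 ?exprn_gt0// ltr_wpDl// mulr_ge0// sqr_ge0.
apply: filterS (step_cvg e1) => k ke l lt.
rewrite -(@ltr_pXn2r _ 2)// ?nnegrE ?enorm_ge0 ?(ltW e0)//.
apply: (le_lt_trans (Z_dist k l)).
apply: (@le_lt_trans _ _ ((t * m ^+ 2) * step k)).
  have -> : l%:R * (step k * m) ^+ 2 = (l%:R * step k) * (step k * m ^+ 2) by ring.
  have -> : t * m ^+ 2 * step k = t * (step k * m ^+ 2) by ring.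
  apply: ler_wpM2r; first by rewrite mulr_ge0 ?sqr_ge0 ?(ltW (step_gt0 k)).
  rewrite (le_trans _ (idx_le k t0))// ler_wpM2r ?ler_nat//.
  exact: ltW.
apply: (@le_lt_trans _ _ ((t * m ^+ 2 + 1) * step k)).
  by rewrite ler_pM2r// lerDl.
by rewrite mulrC -ltr_pdivlMr// ltr_wpDl// mulr_ge0// sqr_ge0.
Qed.

(** Pointwise limits along one ultrafilter suffice. The third property replaces a differential
    inclusion: it bounds the increments by the velocities used at projections close to [y t], where
    all nodes between [t] and [t'] project. *)
Lemma euler_limit : exists y : R -> 'rV[R]_N,
  [/\ y 0 = z0, forall t, 0 <= t -> S (y t) &
    forall t t' q c rho, 0 <= t <= t' -> m * (t' - t) < rho ->
      (forall z, enorm (y t - proj z) < rho -> dot (vel z) q <= c) ->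
      dot (y t' - y t) q <= c * (t' - t)].
Proof.
have [U [UU ooU]] := ultraFilterLemma eventually_filter.
have /choice[y Hy] (t : R) : exists y : 'rV[R]_N, 0 <= t ->
    Z k (idx k t) @[k --> U] --> y.
  have [t0|t0] := leP 0 t; last by exists 0.
  have [|y yU] := @ultra_bounded_cvg R N U (fun k => Z k (idx k t))
    (enorm z0 + t * m) UU.
    move=> k; rewrite -[Z k _](subrK z0) addrC (le_trans (ler_enormD _ _))//.
    rewrite lerD2l (le_trans (Z_lipschitz k (leq0n _)))// subr0.
    by rewrite ler_pM2r// idx_le.
  by exists y.
have y0 : y 0 = z0.
  have H : Z k (idx k 0) @[k --> U] --> z0.
    rewrite (_ : (fun k => _) = fun=> z0); first exact: cvg_cst.
    by apply/funext => k; rewrite /idx mul0r truncn0.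
  exact: (cvg_unique _ (Hy _ (lexx 0)) H).
exists y; split => //.
  move=> t t0; apply/(closed_enormP _).1 => // e e0.
  have e2 : 0 < e / 2 by rewrite divr_gt0.
  have H1 := ooU _ (Z_dist_cvg t0 e2).
  have H2 : \forall k \near U, enorm (y t - Z k (idx k t)) < e / 2.
    by move/cvg_enormP : (Hy t t0); exact.
  have [k [H3 H4]] := filter_ex (filterI H1 H2).
  exists (proj (Z k (idx k t))) => //.
  rewrite (le_lt_trans (ler_enorm_dist (Z k (idx k t)) _ _))//.
  by rewrite [ltRHS]splitr ltrD// H3.
move=> t t' q c rho /andP[t0 tt'] mrho H.
have t'0 : 0 <= t' by exact: le_trans tt'.
(* The slack is shared between the convergence of the nodes at [t], the rounding of times to
   multiples of the step, and the distance of a node to its projection. *)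
pose eta := (rho - m * (t' - t)) / 3.
have eta0 : 0 < eta by rewrite divr_gt0// subr_gt0.
have idx_cvg s : 0 <= s -> (idx k s)%:R * step k @[k --> U] --> s.
  move=> s0; apply/cvgrPdist_lt => e e0; apply: ooU.
  apply: filterS (step_cvg e0) => k ke.
  rewrite ger0_norm ?subr_ge0 ?idx_le//; apply: le_lt_trans ke.
  by rewrite lerBlDr -lerBlDl idx_ge.
have c1 : dot (Z k (idx k t') - Z k (idx k t)) q @[k --> U] --> dot (y t' - y t) q.
  by apply: cvg_dot; [apply: cvgB; exact: Hy|exact: cvg_cst].
have c2 : c * ((idx k t')%:R * step k - (idx k t)%:R * step k) @[k --> U] -->
    c * (t' - t).
  by apply: cvgM; [exact: cvg_cst|apply: cvgB; exact: idx_cvg].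
apply: (ler_cvg_to c1 c2).
have eta1 : 0 < eta / m by rewrite divr_gt0.
have H1 := ooU _ (step_cvg eta1).
have H2 := ooU _ (Z_dist_cvg t'0 eta0).
have H3 : \forall k \near U, enorm (y t - Z k (idx k t)) < eta.
  by move/cvg_enormP : (Hy t t0); exact.
apply: filterS (filterI (filterI H1 H2) H3) => k [[K1 K2] K3].
rewrite -mulrBl mulrC; apply: Z_growth; first exact: idx_mono.
move=> l /andP[il li]; apply: H.
rewrite (le_lt_trans (ler_enorm_dist (Z k l) _ _))//.
rewrite (@lt_le_trans _ _ (eta + (m * (t' - t) + eta) + eta))//; last first.
  by rewrite /eta; lra.
rewrite ltrD ?K2 ?(ltnW li)//.
rewrite (le_lt_trans (ler_enorm_dist (Z k (idx k t)) _ _))//.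
rewrite ltr_leD// enorm_distC (le_trans (Z_lipschitz k il))//.
have : l%:R * step k <= t'.
  by rewrite (le_trans _ (idx_le k t'0))// ler_pM2r// ler_nat ltnW.
have := idx_ge k t0.
have : step k * m < eta by rewrite -ltr_pdivlMr.
move=> A1 A2 A3.
have : (l%:R * step k - (idx k t)%:R * step k) * m <= (t' - t + step k) * m.
  by rewrite ler_pM2r//; lra.
by rewrite mulrBl; lra.
Qed.

End EulerLimit.

(** * Sufficiency *)

Lemma lipschitz_derivable_ae (R : realType) (n : nat) (x : R -> 'rV[R]_n) (c a b : R) :
  0 < c -> (forall s t, enorm (x s - x t) <= c * `|s - t|) ->
  {ae (@lebesgue_measure R), forall t, a < t < b -> derivable x t 1}.
Proof.
move=> c0 lipx.
have H (i : 'I_n) : {ae (@lebesgue_measure R), forall t, a < t < b ->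
    derivable (fun s => x s 0 i) t 1}.
  apply: (lipschitz_ae_derivable _ _ c0) => s t.
  rewrite (le_trans _ (lipx s t))// (le_trans _ (coord_le_enorm _ i))//.
  by rewrite !mxE.
have : {ae (@lebesgue_measure R), forall t, forall i : 'I_n, a < t < b ->
    derivable (fun s => x s 0 i) t 1}.
  by apply: filter_forall => i; exact: H.
apply: filterS; first exact: (ae_filter_ringOfSetsType (@lebesgue_measure R)).
move=> t Ht tab; apply/derivable_mxP => i j.
by rewrite (ord1 i); exact: Ht.
Qed.

(* Separation: compare [w] with its nearest point [w'] of [A] in the direction
   [w - w']. *)
Lemma convex_support_mem (R : realType) (n : nat) (A : set 'rV[R]_n) (w : 'rV[R]_n) :
  closed A -> A !=set0 ->
  (forall u v l, 0 <= l <= 1 -> A u -> A v -> A ((1 - l) *: u + l *: v)) ->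
  (forall q c, (forall v, A v -> dot v q <= c) -> dot w q <= c) -> A w.
Proof.
move=> cA A0 convA supp; have [w' Aw' w'min] := nearest_point w cA A0.
suff -> : w = w' by [].
apply/eqP; rewrite -subr_eq0; apply/eqP; apply: enorm_eq0; apply/eqP.
rewrite -sqrf_eq0 eq_le sqr_ge0 andbT.
suff : dot w (w - w') <= dot w' (w - w').
  by rewrite enorm_sqr dotBl subr_le0.
apply: supp => v Av; rewrite -subr_le0 -dotBl.
have [_ [sigma [sigma0 Nw]]] := proximal_normal_nearest Aw' w'min.
rewrite leNgt; apply/negP => pos; set D := dot _ _ in pos.
(* The point at parameter [l] of the segment from [w'] to [v] violates the normal inequality at
   [w']: there the linear term [l * D] exceeds the quadratic one. *)
pose l := Num.min 1 (D / (2 * (sigma * enorm (v - w') ^+ 2 + 1))).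
have s1 : 0 < sigma * enorm (v - w') ^+ 2 + 1 by rewrite ltr_wpDl// mulr_ge0// sqr_ge0.
have l0 : 0 < l by rewrite lt_min ltr01 divr_gt0// mulr_gt0.
have l1 : l <= 1 by rewrite ge_min lexx.
have l01 : 0 <= l <= 1 by rewrite (ltW l0).
have := Nw _ (convA _ _ _ l01 Aw' Av).
have -> : (1 - l) *: w' + l *: v - w' = l *: (v - w').
  by rewrite scalerBl scale1r scalerBr addrAC [w' - _ - _]addrAC subrr add0r addrC.
rewrite dotZr enormZ (gtr0_norm l0) dotC -/D exprMn mulrCA [l ^+ 2]expr2 -mulrA.
rewrite ler_pM2l// leNgt => /negP; apply.
apply: (@le_lt_trans _ _ (l * (sigma * enorm (v - w') ^+ 2 + 1))).
  by rewrite ler_pM2l// lerDl.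
apply: (@le_lt_trans _ _ (D / 2)); last by rewrite ltr_pdivrMr// ltr_pMr// ltrDl.
by rewrite -ler_pdivlMr// -mulrA -invfM ge_min lexx orbT.
Qed.

Section Sufficiency.
Context {R : realType} {n : nat}.
Variables (C : R -> set 'rV[R]_n) (G : R -> 'rV[R]_n -> set 'rV[R]_n).
Variables (K : set 'rV[R]_n) (L_C M L_G : R).
Hypotheses (hC : HC C L_C) (hG : HG G M L_G) (hK : closed K).
Local Notation mu := (@lebesgue_measure R).
Local Notation S := (graph C `&` time_cylinder K).
Local Notation V := (velocity C G (L_C + M)).
Local Notation m := (1 + (L_C + M + M)).

Hypothesis hmin : forall (t : R) (x : 'rV[R]_n), S (tx t x) ->
  forall p, proximal_normal S (tx t x) p ->
    sum_of_mins_le0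
      [set tx 0 v | v in [set - zeta | zeta in proximal_normal (C t) x]
                         `&` eball (L_C + M)]
      [set tx 1 g | g in G t x] p.

Let m_ge1 : 1 <= m.
Proof.
have L0 := HC_constant_ge0 hC; have M0 := HG_bound_ge0 hG.
by rewrite lerDl !addr_ge0.
Qed.

Let m_gt0 : 0 < m. Proof. exact: lt_le_trans m_ge1. Qed.

(** The velocity is the sum of the minimisers of the two minima for the proximal normal from the
    projection to [z]; their time components 0 and 1 add up to 1. *)
Lemma aiming_velocity z : S !=set0 -> exists a : R * 'rV[R]_n * 'rV[R]_n,
  let: (t, x, w) := a in
  [/\ S (tx t x), forall y, S y -> enorm (z - tx t x) <= enorm (z - y),
      V t x w & dot (tx 1 w) (z - tx t x) <= 0].
Proof.
move=> S0.
have [s Ss smin] := nearest_point z (graph_cylinder_closed hC hK) S0.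
have [t [x sE]] := tx_surj s; rewrite {}sE in Ss smin.
have [a [b [[[_ [v [[zeta Nz vE] vB] <-] aE] _] [[_ [g Gg <-] bE] _] ab]]] :=
  hmin Ss (proximal_normal_nearest Ss smin).
exists (t, x, v + g); split => //.
  exists zeta; last by exists g => //; rewrite vE.
  by split => //; move: vB; rewrite -vE /eball/= enormN.
by rewrite -[1]add0r -txD dotDl aE bE.
Qed.

Lemma viable_curve t0 x0 : S (tx t0 x0) -> exists x : R -> 'rV[R]_n,
  [/\ x 0 = x0,
      forall t, 0 <= t -> S (tx (t0 + t) (x t)),
      forall s t, 0 <= s <= t -> enorm (x t - x s) <= m * (t - s) &
      forall t q c e, 0 <= t -> 0 < e -> (forall w, V (t0 + t) (x t) w -> dot w q <= c) ->
        exists2 d, 0 < d & forall t', t <= t' < t + d ->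
          dot (x t' - x t) q <= (c + e) * (t' - t)].
Proof.
move=> Sx0; have [t0_ge0 _ _] := (graph_cylinderP _ _ _ _).1 Sx0.
have /choice[a Ha] z := aiming_velocity z (ex_intro _ _ Sx0).
pose proj z := tx (a z).1.1 (a z).1.2; pose vel z := tx 1 (a z).2.
have {}Ha z : [/\ S (proj z), forall y, S y -> enorm (z - proj z) <= enorm (z - y),
    V (a z).1.1 (a z).1.2 (a z).2 & dot (vel z) (z - proj z) <= 0].
  by have := Ha z; rewrite /proj /vel; case: (a z) => [[]].
have proj0 z : 0 <= (a z).1.1 /\ C (a z).1.1 (a z).1.2.
  by have [/graph_cylinderP[? ?]] := Ha z.
have vel_le z : enorm (vel z) <= m.
  rewrite (le_trans (enorm_tx_le _ _))// normr1 lerD2l.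
  have [_ _ Vz _] := Ha z; exact: (velocity_bounded hG (proj0 z).1 Vz).
have [||||||y [y0 Sy growth]] := @euler_limit R (1 + n) S proj vel m (tx t0 x0) _ _ m_gt0.
- exact: (graph_cylinder_closed hC hK).
- exact: Sx0.
- by move=> z; have [] := Ha z.
- by move=> z; have [] := Ha z.
- exact: vel_le.
- by move=> z; have [] := Ha z.
(* When the bound holds for every velocity, any radius exceeding [m * (t' - t)] will do. *)
have growth' t t' q c : 0 <= t <= t' -> (forall z, dot (vel z) q <= c) ->
    dot (y t' - y t) q <= c * (t' - t).
  by move=> tt' H; apply: (growth _ _ _ _ (m * (t' - t) + 1)) => //; rewrite ltrDl.
(* All velocities have time component 1, so growth in the directions [tx 1 0] and [tx (-1) 0] pins
   down the time component of [y]. *)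
have /choice[x Hx] (t : R) : exists x, 0 <= t -> y t = tx (t0 + t) x.
  have [t_ge0|t_lt0] := leP 0 t; last by exists 0.
  have [b [x yE]] := tx_surj (y t); exists x => _; rewrite yE; congr tx.
  have t_itv : (0 : R) <= 0 <= t by rewrite lexx.
  have := @growth' 0 t (tx 1 0) 1 t_itv.
  have := @growth' 0 t (tx (-1) 0) (-1) t_itv.
  rewrite y0 yE txB !dot_tx !dot0r => A1 A2.
  have {}A1 : (b - t0) * -1 + 0 <= -1 * (t - 0).
    by apply: A1 => z; rewrite dot_tx dot0r mul1r addr0.
  have {}A2 : (b - t0) * 1 + 0 <= 1 * (t - 0).
    by apply: A2 => z; rewrite dot_tx dot0r mul1r addr0.
  lra.
exists x; split.
- have := Hx 0 (lexx 0); rewrite y0 addr0 => E.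
  by have [_ ->] := tx_inj E.
- by move=> t t_ge0; rewrite -Hx//; exact: Sy.
- move=> s t /andP[s0 st]; have t_ge0 := le_trans s0 st.
  apply: (le_trans (enorm_le_enorm_tx (t - s) _)).
  have -> : tx (t - s) (x t - x s) = y t - y s.
    by rewrite !Hx// txB; congr tx; ring.
  set q := y t - y s.
  have [q0|q0] := eqVneq (enorm q) 0.
    by rewrite q0 mulr_ge0 ?subr_ge0// ltW.
  have qp : 0 < enorm q by rewrite lt_neqAle eq_sym q0 enorm_ge0.
  rewrite -(ler_pM2r qp) -expr2 enorm_sqr mulrAC.
  apply: growth'; first by rewrite s0.
  move=> z; rewrite (le_trans (dot_le_enorm _ _))// ler_wpM2r ?enorm_ge0//.
- move=> t q c e t_ge0 e0 Hc.
  have /graph_cylinderP[tt0 Ct _] : S (tx (t0 + t) (x t)) by rewrite -Hx//; exact: Sy.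
  have [rho rho0 usc] := velocity_usc hC hG (L_C + M) q tt0 Ct e0.
  (* Moving at speed at most [m], the curve needs time [rho / m] to leave the ball where
     [velocity_usc] applies. *)
  exists (rho / m); first by rewrite divr_gt0.
  move=> t' /andP[tt' t'd].
  have -> : dot (x t' - x t) q = dot (y t' - y t) (tx 0 q).
    by rewrite !Hx ?(le_trans t_ge0)// txB dot_tx mulr0 add0r.
  apply: (growth _ _ _ _ rho).
  + by rewrite t_ge0.
  + by rewrite mulrC -ltr_pdivlMr// ltrBlDl.
  move=> z; rewrite Hx// /proj txB /vel dot_tx mulr0 add0r => zrho.
  have [_ _ Vz _] := Ha z.
  have [||w Vw] := usc _ _ _ (proj0 z).1 (proj0 z).2 _ _ Vz.
  + exact: le_lt_trans (normr_le_enorm_tx _ _) zrho.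
  + exact: le_lt_trans (enorm_le_enorm_tx _ _) zrho.
  by move=> /le_trans; apply; rewrite lerD2r; exact: Hc.
Qed.

Lemma weak_invariance_sufficient : weakly_invariant C G (time_cylinder K).
Proof.
move=> t0 x0 Sx0; have [t0_ge0 _ _] := (graph_cylinderP _ _ _ _).1 Sx0.
have [x [x_0 Sx lipx growth]] := viable_curve Sx0.
(* The constant extension to negative times is Lipschitz on the whole line, as almost everywhere
   differentiability demands. *)
pose X t := x (Num.max t 0).
have XE t : 0 <= t -> X t = x t by move=> t_ge0; rewrite /X max_l.
have lipX s t : enorm (X s - X t) <= m * `|s - t|.
  wlog st : s t / s <= t => [H|].
    by have [/H//|/ltW /H] := leP s t; rewrite enorm_distC distrC.
  rewrite enorm_distC (le_trans (lipx (Num.max s 0) (Num.max t 0) _))//.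
    by rewrite le_max lexx orbT/= ge_max !le_max st lexx orbT.
  rewrite ler_pM2l// distrC ger0_norm ?subr_ge0//.
  have [s0|s0] := leP s 0; have [t0'|t0'] := leP t 0; lra.
exists 1, (fun t => t0 + t), X; split => //; last first.
  move=> t /andP[t_ge0 _]; rewrite XE//.
  by have [_] := Sx t t_ge0.
split.
- move=> e e0; have m1 : 0 < 1 + m by rewrite addr_gt0.
  exists (e / (1 + m)); first exact: divr_gt0.
  move=> k u v uv _; rewrite ltr_pdivlMr//; apply: le_lt_trans.
  rewrite mulr_suml ler_sum// => i _; have [_ [uvi _]] := uv i.
  rewrite txB (le_trans (enorm_tx_le _ _))// mulrDr mulr1.
  have -> : t0 + v i - (t0 + u i) = v i - u i by ring.
  rewrite ger0_norm ?subr_ge0// lerD2l mulrC.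
  by rewrite -[X in m * X]ger0_norm ?subr_ge0//; exact: lipX.
- by split; [exact: addr0|rewrite XE].
- move=> t /andP[t_ge0 _]; rewrite XE//.
  by have /graph_cylinderP[] := Sx t t_ge0.
(* The open interval from -1 to 2 contains the closed time interval, end points included. *)
have := @lipschitz_derivable_ae _ _ X m (-1) 2 m_gt0 lipX.
apply: filterS; first exact: (ae_filter_ringOfSetsType mu).
move=> t Ht /andP[t_ge0 t1].
have dX : derivable X t 1 by apply: Ht; lra.
have [dtau tau1] : derivable (fun s => t0 + s) t 1 /\ derive1 (fun s => t0 + s) t = 1.
  apply: derive1_of_cvg; apply/cvgrPdist_lt => e e0; near=> h.
  have h0 : h != 0 by near: h; exact: nbhs_dnbhs_neq.
  rewrite (_ : t0 + (h + t) - (t0 + t) = h); last by ring.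
  by rewrite mulVf// subrr normr0.
split => //.
have /graph_cylinderP[tt0 Ct _] := Sx t t_ge0.
suff : V (t0 + t) (X t) (derive1 X t).
  by move=> [z [Nz _] [g Gg E]]; exists z => //; exists g.
rewrite {1}XE//; apply: convex_support_mem.
- exact: (velocity_closed hC hG (t := t0 + t) (x := x t)).
- apply: (velocity_nonempty hG) => //.
  by rewrite addr_ge0 ?(HC_constant_ge0 hC) ?(HG_bound_ge0 hG).
- by move=> u v l l01; exact: (velocity_convex hG).
(* The growth bound on a forward increment and the expansion of [X] at [t] each cost [e / 2] per
   unit of time; dividing by [h] bounds the derivative in direction [q]. *)
move=> q c Hc; apply/ler_addgt0Pr => e e0.
have e2 : 0 < e / 2 by rewrite divr_gt0.
have [d1 d10 H1] := growth t q c _ t_ge0 e2 Hc.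
have e3 : 0 < e / 2 / (enorm q + 1) by rewrite !divr_gt0// ltr_wpDl// enorm_ge0.
have [d2 d20 H2] := derivable_enorm_expansion dX e3.
pose h := Num.min d1 d2 / 2.
have h0 : 0 < h by rewrite divr_gt0// lt_min d10.
have hd1 : h < d1.
  by rewrite ltr_pdivrMr// gt_min; apply/orP; left; rewrite ltr_pMr// ltrDl.
have hd2 : h < d2.
  by rewrite ltr_pdivrMr// gt_min; apply/orP; right; rewrite ltr_pMr// ltrDl.
have := H2 (t + h); rewrite addrAC subrr add0r gtr0_norm// => /(_ hd2).
set r := _ - _ => rh.
have := H1 (t + h); rewrite lerDl (ltW h0) ltrD2l hd1 => /(_ isT).
rewrite -!XE ?addr_ge0 ?(ltW h0)// [t + h - t]addrAC subrr add0r.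
have -> : X (t + h) - X t = r + h *: derive1 X t by rewrite /r subrK.
rewrite dotDl dotZl => A1.
have A2 : - dot r q <= e / 2 * h.
  rewrite -dotNl (le_trans (dot_le_enorm _ _))// enormN.
  apply: (@le_trans _ _ (e / 2 / (enorm q + 1) * h * enorm q)).
    by rewrite ler_wpM2r ?enorm_ge0.
  apply: (@le_trans _ _ (e / 2 / (enorm q + 1) * h * (enorm q + 1))).
    by rewrite ler_wpM2l ?lerDl// mulr_ge0 ?ltW.
  by rewrite mulrAC divfK// gt_eqF// ltr_wpDl// enorm_ge0.
rewrite -(ler_pM2r h0); lra.
Unshelve. all: by end_near. Qed.

End Sufficiency.

Theorem theorem4p3 (R : realType) (n : nat)
    (C : R -> set 'rV[R]_n) (G : R -> 'rV[R]_n -> set 'rV[R]_n)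
    (K : set 'rV[R]_n) (L_C M L_G : R)
    (hC : HC C L_C) (hG : HG G M L_G)
    (hK : closed K) (hCK : forall t : R, 0 <= t -> C t `&` K !=set0) :
  weakly_invariant C G (time_cylinder K) <->
  (forall (t : R) (x : 'rV[R]_n), (graph C `&` time_cylinder K) (tx t x) ->
    forall p : 'rV[R]_(1 + n),
      proximal_normal (graph C `&` time_cylinder K) (tx t x) p ->
      sum_of_mins_le0
        [set tx 0 v | v in [set - zeta | zeta in proximal_normal (C t) x]
                           `&` eball (L_C + M)]
        [set tx 1 g | g in G t x]
        p).
Proof.
split=> [winv t x Sx p Np|H].
  exact: (weak_invariance_necessary hC hG winv Sx Np).
exact: (weak_invariance_sufficient hC hG hK H).
Qed.
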